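(* Let $r\ge 6$ and $n\ge 5r+18$ be integers. Then $$\sigma\big(K_{r+1}-(K_3\cup P_3),\,n\big)=\begin{cases}(r-1)(2n-r)-3(n-r)-1, & \text{if } n-r \text{ is odd},\\ (r-1)(2n-r)-3(n-r), & \text{if } n-r \text{ is even}.\end{cases}$$
   Context: A sequence $\pi=(d_1,\dots,d_n)$ of non-increasing nonnegative integers is graphic if it is the degree sequence of a simple graph on $n$ vertices (a realization of $\pi$); write $\sigma(\pi)=d_1+\dots+d_n$. For a graph $H$, $\pi$ is potentially $H$-graphic if some realization of $\pi$ contains $H$ as a (not necessarily induced) subgraph. $\sigma(H,n)$ denotes the smallest even integer $l$ such that every $n$-term graphic sequence $\pi$ with $\sigma(\pi)\ge l$ is potentially $H$-graphic. For a graph $H$ that is a subgraph of $K_m$, $K_m-H$ is the graph obtained from $K_m$ by deleting the edges of $H$. $K_3$ is the triangle, $P_3$ denotes the path with $3$ edges (on $4$ vertices), and $K_3\cup P_3$ is their disjoint union (7 vertices, 6 edges). *)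

(* Defs.v *)
From mathcomp Require Import all_boot.
Set Implicit Arguments. Unset Strict Implicit. Unset Printing Implicit Defensive.

Definition simple_graph (n : nat) (g : rel 'I_n) : Prop :=
  symmetric g /\ irreflexive g.

Definition deg (n : nat) (g : rel 'I_n) (i : 'I_n) : nat := #|[set j | g i j]|.

Definition seq_sum (pi : seq nat) : nat := sumn pi.

Definition realization (n : nat) (g : rel 'I_n) (pi : seq nat) : Prop :=
  simple_graph g /\ size pi = n /\ forall i : 'I_n, deg g i = nth 0 pi i.

Definition graphic (n : nat) (pi : seq nat) : Prop :=
  sorted geq pi /\ size pi = n /\ exists g : rel 'I_n, realization g pi.

Definition contains_subgraph (n m : nat) (g : rel 'I_n) (H : rel 'I_m) : Prop :=
  exists f : 'I_m -> 'I_n, injective f /\ forall i j, H i j -> g (f i) (f j).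

Definition potentially_graphic (m : nat) (H : rel 'I_m) (n : nat) (pi : seq nat)
  : Prop :=
  exists g : rel 'I_n, realization g pi /\ contains_subgraph g H.

Definition sigma_prop (m : nat) (H : rel 'I_m) (n l : nat) : Prop :=
  forall pi : seq nat, graphic n pi -> l <= seq_sum pi -> potentially_graphic H n pi.

Definition is_sigma (m : nat) (H : rel 'I_m) (n v : nat) : Prop :=
  ~~ odd v /\ sigma_prop H n v /\
  forall l : nat, ~~ odd l -> sigma_prop H n l -> v <= l.

(* The edges of K_3 \cup P_3 placed on vertices 0,1,2 (triangle) and
   3-4-5-6 (path with 3 edges). *)
Definition K3P3_edge (a b : nat) : bool :=
  (minn a b, maxn a b) \in [:: (0,1); (0,2); (1,2); (3,4); (4,5); (5,6)].

(* K_{r+1} - (K_3 \cup P_3), on vertex set 'I_(r+1) (requires r+1 >= 7). *)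
Definition Kr1_minus_K3P3 (r : nat) : rel 'I_(r.+1) :=
  fun i j => (i != j) && ~~ K3P3_edge i j.
Arguments Kr1_minus_K3P3 r : clear implicits.

(* Main.v *)
(* Lower bound: let r - 3 vertices be joined to everything and let the other n - r + 3
   vertices span a perfect matching, or a path with two edges and a perfect matching.
   Four of the latter vertices span at most two edges in any realization, while any four
   vertices of K_{r+1} - (K_3 u P_3) span at least three.

   Upper bound: induction on r. If r + 1 vertices have degree at least r, remove a vertex
   v of maximum degree: the degree sum of the rest is still large enough for r - 1, and
   the pattern T found there can be moved to vertices of largest degree. Take a
   realization in which v has as many neighbours in T as possible. If v misses some z in
   T, then no exchange on two or three edges gains the edge vz, so every edge outside
   C = T + v touches a small set around a common outer neighbour of v and z; this bounds
   the degree sum, or else yields a clique on r + 1 vertices.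
   If at most r vertices have degree at least r, let C consist of the r + 1 largest
   degrees and maximize the number of edges inside C. The same exchanges show that of two
   nonadjacent vertices of C one has no neighbour outside C. A second exchange and the
   degree sum leave at most three nonadjacent pairs in C, and three pairs at a common
   vertex can be switched into a path. *)
Require Import Defs.
From mathcomp Require Import all_boot zify perm.
From Stdlib Require Import Classical.
Set Implicit Arguments. Unset Strict Implicit. Unset Printing Implicit Defensive.

(** * Degree-preserving exchanges *)

(** Let [f(r, n) = 2 r n - r^2 - 5 n + 4 r - 1], the value for odd [n - r]. The degree-sum
    hypothesis is [f(r, n) <= sum], written without subtraction. Two identities shape the proof.
    First, [f(r + 1, n) - f(r, n - 1) = 2 (n - 1)], which is the most that deleting one vertex can
    cost; so the induction loses nothing, and it can start at [r = 2], where [K_3] minus a triangle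
    has no edges. Second, a complete core on [r + 1] vertices together with outer vertices that
    account for [2 r - 5] each has degree sum [f(r, n) + 6]. The surplus 6 is three nonadjacent
    pairs counted twice, and among graphs with three edges only the star fails to embed in K_3 u
    P_3. The factor 5 in [5 r + 18] comes from the removal step: without a clique or an exchange,
    [(2 r - 3) n] is at most [10 r^2 + 3 r - 2]. The recurring obstacle is that a change of
    realization may destroy the pattern found so far. Hence [addable] only admits realizations that
    keep every edge inside [C]. *)

Section Graphs.
Variable V : finType.
Implicit Types (G : rel V) (C S : {set V}).

Definition sgraph G := symmetric G /\ irreflexive G.
Definition nb G x := [set y | G x y].
Definition dg G x := #|nb G x|.

Lemma in_nb G x y : (y \in nb G x) = G x y. Proof. by rewrite inE. Qed.

Lemma adj_neq G x y : sgraph G -> G x y -> x != y.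
Proof. by move=> [_ I] g; apply/eqP => E; rewrite E I in g. Qed.

Definition same_pair (a b x y : V) := (x == a) && (y == b) || (x == b) && (y == a).
Definition switch G a b c d : rel V := fun x y =>
  (same_pair a d x y || same_pair c b x y) || [&& G x y, ~~ same_pair a b x y & ~~ same_pair c d x y].

Lemma same_pair_sym a b x y : same_pair a b x y = same_pair a b y x.
Proof. by rewrite /same_pair orbC (andbC (y == a)) (andbC (y == b)). Qed.

Lemma same_pairxx a b x : a != b -> same_pair a b x x = false.
Proof. by rewrite /same_pair andbC orbb; case: (eqVneq x b) => //= ->; rewrite eq_sym => /negbTE. Qed.

Lemma switch_spec G a b c d : sgraph G -> G a b -> G c d ->
  a != d -> c != b -> ~~ G a d -> ~~ G c b ->
  sgraph (switch G a b c d) /\ dg (switch G a b c d) =1 dg G.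
Proof.
move=> sG gab gcd nad ncb nGad nGcb; have [S I] := sG.
have nab := adj_neq sG gab; have ncd := adj_neq sG gcd.
have nac : a != c by apply: contraNneq nGcb => <-.
have nbd : b != d by apply: contraNneq nGad => <-.
have sy : symmetric (switch G a b c d).
  by move=> x y; rewrite /switch !(same_pair_sym _ _ y) S.
split.
  by split=> // x; rewrite /switch I !same_pairxx.
have aux : forall p q s, G p q -> ~~ G p s ->
    nb (switch G a b c d) p = s |: (nb G p :\ q) -> dg (switch G a b c d) p = dg G p.
  move=> p q s gpq ngps E; rewrite /dg E cardsU1 !inE (negbTE ngps) andbF /=.
  by rewrite [in RHS](cardsD1 q) in_nb gpq.
have E : forall y, (switch G a b c d a y = (y == d) || G a y && (y != b)) *
  (switch G a b c d c y = (y == b) || G c y && (y != d)) *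
  (switch G a b c d b y = (y == c) || G b y && (y != a)) *
  (switch G a b c d d y = (y == a) || G d y && (y != c)).
  move=> y; rewrite /switch /same_pair !eqxx.
  rewrite ?(eq_sym d a) ?(eq_sym b a) ?(eq_sym c a) ?(eq_sym d b) ?(eq_sym c b) ?(eq_sym d c).
  rewrite ?(eq_sym b c) ?(eq_sym b a).
  rewrite !(negbTE nab, negbTE nac, negbTE nad, negbTE nbd, negbTE ncd, negbTE ncb) /=.
  by rewrite ?orbF ?andbT.
move=> x; case: (eqVneq x a) => [->|xa].
  by apply: (aux _ b d) => //; apply/setP => y; rewrite !inE E andbC.
case: (eqVneq x c) => [->|xc].
  by apply: (aux _ d b) => //; apply/setP => y; rewrite !inE E andbC.
case: (eqVneq x b) => [->|xb].
  by apply: (aux _ a c); rewrite 1?S // 1?S //; apply/setP => y; rewrite !inE E andbC.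
case: (eqVneq x d) => [->|xd].
  by apply: (aux _ c a); rewrite 1?S // 1?S //; apply/setP => y; rewrite !inE E andbC.
by apply: eq_card => y; rewrite !inE /switch /same_pair (negbTE xa) (negbTE xb) (negbTE xc) (negbTE xd) /= andbT.
Qed.

Definition addable G C u v := exists G', [/\ sgraph G', dg G' =1 dg G,
  {in C &, forall x y, G x y -> G' x y} & G' u v].

Lemma addable_trans G G1 C u v : dg G1 =1 dg G ->
  {in C &, forall x y, G x y -> G1 x y} -> addable G1 C u v -> addable G C u v.
Proof.
move=> d1 c1 [G' [s d c g]]; exists G'; split=> // [x|x y xC yC h].
  by rewrite d d1.
by apply: c => //; apply: c1.
Qed.

Lemma switch_in G a b c d C : a \notin C \/ b \notin C -> c \notin C \/ d \notin C ->
  {in C &, forall x y, G x y -> switch G a b c d x y}.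
Proof.
move=> h1 h2 x y xC yC g; rewrite /switch g /=; apply/orP; right.
rewrite /same_pair; apply/andP; split; rewrite negb_or !negb_and.
  by case: h1 => h; case: (eqVneq x a) (eqVneq y a) (eqVneq x b) (eqVneq y b) =>
    [E|?] [E'|?] [E2|?] [E3|?] //=; subst; rewrite ?xC ?yC in h.
by case: h2 => h; case: (eqVneq x c) (eqVneq y c) (eqVneq x d) (eqVneq y d) =>
    [E|?] [E'|?] [E2|?] [E3|?] //=; subst; rewrite ?xC ?yC in h.
Qed.

(** Trade [uw], [bv] for [uv], [bw]. Both lost edges have an end outside [C]. *)
Lemma exchange2 G C u v w b : sgraph G -> u != v -> ~~ G u v ->
  G u w -> w \notin C -> G v b -> b \notin C -> w != b -> ~~ G w b ->
  addable G C u v.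
Proof.
move=> sG nuv nguv guw wC gvb bC nwb ngwb; have [S I] := sG.
have gbv : G b v by rewrite S.
have [] := switch_spec sG guw gbv nuv; rewrite 1?eq_sym // 1?S //.
move=> s d; exists (switch G u w b v); split=> //.
  by apply: switch_in; [right|left].
by rewrite /switch /same_pair !eqxx.
Qed.

(** Trading [vb], [yx] for [vx], [yb] makes [x] an outer neighbour of [v] that is not adjacent to
    [w]; then [exchange2] applies. *)
Lemma exchange3_half G C u v w b x y : sgraph G -> u \in C -> v \in C ->
  u != v -> ~~ G u v ->
  G u w -> w \notin C -> G v b -> b \notin C ->
  G x y -> x \notin C -> x != w -> ~~ G w x -> y != b -> ~~ G b y ->
  addable G C u v.
Proof.
move=> sG uC vC nuv nguv guw wC gvb bC gxy xC nxw ngwx nyb ngby; have [S I] := sG.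
have [gvx|ngvx] := boolP (G v x); first by apply: (@exchange2 _ _ _ _ w x); rewrite // eq_sym.
have nvx : v != x by apply: contraTneq vC => ->.
have gyx : G y x by rewrite S.
have ngyb : ~~ G y b by rewrite S.
have [s d] := switch_spec sG gvb gyx nvx nyb ngvx ngyb.
have cc : {in C &, forall p q, G p q -> switch G v b y x p q}.
  by apply: switch_in; right.
have nwx : w != x by rewrite eq_sym.
have nbx : b != x by apply: contraNneq ngby => ->.
have nux : u != x by apply: contraTneq uC => ->.
have nub : u != b by apply: contraTneq uC => ->.
have nwv : w != v by apply: contraNneq wC => ->.
apply: (addable_trans d cc).
have [//|ng1] := boolP (switch G v b y x u v).
  by move=> g1; exists (switch G v b y x); split.
apply: (@exchange2 _ _ _ _ w x) => //.
- rewrite /switch guw /= /same_pair (negbTE nuv) (negbTE nux) (negbTE nub) (negbTE nwv) (negbTE nwx) /=.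
  by rewrite !andbF !orbT.
- by rewrite /switch /same_pair !eqxx.
rewrite /switch (negbTE ngwx) /= orbF /same_pair (negbTE nwv) (negbTE nwx) /= negb_or !negb_and.
by rewrite (eq_sym x b) nbx (eq_sym x y) (adj_neq sG gyx) !orbT.
Qed.

Lemma exchange3 G C u v w b x y : sgraph G -> u \in C -> v \in C ->
  u != v -> ~~ G u v ->
  G u w -> w \notin C -> G v b -> b \notin C ->
  G x y -> x \notin C \/ y \notin C -> x != w -> ~~ G w x -> y != b -> ~~ G b y ->
  addable G C u v.
Proof.
move=> sG uC vC nuv nguv guw wC gvb bC gxy [xC|yC] nxw ngwx nyb ngby.
  exact: (@exchange3_half _ _ _ _ w b x y).
have [S _] := sG.
have [G' [s d c g]] : addable G C v u.
  by apply: (@exchange3_half _ _ _ _ b w y x) => //; rewrite 1?eq_sym // S.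
by exists G'; split=> //; rewrite s.1.
Qed.

End Graphs.

(** * Patterns and their relocation *)

(** Used to choose extremal realizations: these are functions cut out by an arbitrary proposition,
    so the maximum is found classically, by induction on the gap to the bound. *)
Lemma max_exists (T : Type) (P : T -> Prop) (f : T -> nat) (B : nat) :
  (exists t, P t) -> (forall t, P t -> f t <= B) ->
  exists2 t, P t & forall t', P t' -> f t' <= f t.
Proof.
move=> [t0 Pt0] ub; have [k Hk] := ubnP (B - f t0).
elim: k t0 Pt0 Hk => // k IH t0 Pt0 Hk.
have [[t1 [Pt1 lt1]]|no] := classic (exists t1, P t1 /\ f t0 < f t1).
  by apply: (IH t1) => //; have := ub _ Pt1; lia.
exists t0 => // t' Pt'; rewrite leqNgt; apply/negP => lt; apply: no.
by exists t'.
Qed.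

Section FinSets.
Variable V : finType.
Implicit Types A B C U : {set V}.

Lemma subset_of_card A k : k <= #|A| -> exists2 B : {set V}, B \subset A & #|B| = k.
Proof.
move=> le; exists [set x in take k (enum A)].
  by apply/subsetP => x; rewrite inE => /mem_take; rewrite mem_enum.
rewrite cardsE (card_uniqP _) ?take_uniq ?enum_uniq // size_takel //.
by rewrite -cardE.
Qed.

Lemma top_set U (f : V -> nat) k : k <= #|U| -> exists C : {set V},
  [/\ C \subset U, #|C| = k & forall c o, c \in C -> o \in U -> o \notin C -> f o <= f c].
Proof.
elim: k => [_|k IH lt].
  by exists set0; split; rewrite ?sub0set ?cards0 // => c o; rewrite inE.
have [C [CU Ck top]] := IH (ltnW lt).
have /card_gt0P [m0 m0D] : 0 < #|U :\: C| by rewrite cardsD (setIidPr CU) Ck; lia.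
have [m mD mmax] := @arg_maxnP _ m0 (mem (U :\: C)) f m0D.
move: mD; rewrite !inE => /andP[mC mU].
exists (m |: C); split.
- by rewrite subUset sub1set mU.
- by rewrite cardsU1 mC Ck.
move=> c o; rewrite !inE => /orP[/eqP->|cC] oU /norP[om oC]; last exact: top.
by apply: mmax; rewrite !inE oC.
Qed.

End FinSets.

Definition K3P3_nbrs (a : nat) : seq nat :=
  nth [::] [:: [:: 1; 2]; [:: 0; 2]; [:: 0; 1]; [:: 4]; [:: 3; 5]; [:: 4; 6]; [:: 5]] a.

Lemma K3P3_edgeP a b : K3P3_edge a b -> b \in K3P3_nbrs a.
Proof.
rewrite /K3P3_edge !inE !xpair_eqE /minn /maxn => h.
have a7 : a < 7 by case: ifP h; lia.
by case: a a7 h => [|[|[|[|[|[|[|a]]]]]]] //=; rewrite !inE; case: ifP; lia.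
Qed.

Lemma size_K3P3_nbrs a : size (K3P3_nbrs a) <= 2.
Proof. by case: a => [|[|[|[|[|[|[|a]]]]]]] //; rewrite /K3P3_nbrs nth_default. Qed.

Lemma K3P3_edge_sym a b : K3P3_edge a b = K3P3_edge b a.
Proof. by rewrite /K3P3_edge minnC maxnC. Qed.

Section Good.
Variable V : finType.
Implicit Types (G : rel V) (A B C S T U Z : {set V}).

(* The complement of [G] on [C] embeds in [K_3 u P_3]; a vertex with a label [>= 7] is
   adjacent to the rest of [C], so [C] may have any size. *)
Definition good G C := exists l : V -> nat, {in C &, injective l} /\
  {in C &, forall x y, x != y -> ~~ G x y -> K3P3_edge (l x) (l y)}.

Lemma good_nonadj G C x : good G C -> x \in C ->
  #|[set y in C | (y != x) && ~~ G x y]| <= 2.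
Proof.
move=> [l [inj lE]] xC.
rewrite cardE -(size_map l) (leq_trans _ (size_K3P3_nbrs (l x))) //.
apply: uniq_leq_size.
  rewrite map_inj_in_uniq ?enum_uniq // => y z; rewrite !mem_enum !inE.
  by move=> /andP[yC _] /andP[zC _]; apply: inj.
move=> k /mapP[y]; rewrite mem_enum inE => /and3P[yC yx ng] ->.
by apply: K3P3_edgeP; apply: lE; rewrite // eq_sym.
Qed.

Lemma good_clique G C : {in C &, forall x y, x != y -> G x y} -> good G C.
Proof.
move=> cl; exists (fun x => val (enum_rank x)); split=> [x y _ _|x y xC yC nxy].
  by move=> /val_inj/enum_rank_inj.
by rewrite cl.
Qed.

Lemma good_addv G T v : symmetric G -> v \notin T -> good G T -> {in T, forall x, G v x} ->
  good G (v |: T).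
Proof.
move=> S vT [l [inj lE]] dom.
(* A fresh label. It may lie below 7, which is harmless because [v] misses no vertex of [T]. *)
pose m := (\max_(x in T) l x).+1.
have lm x : x \in T -> l x < m by move=> xT; rewrite ltnS; apply: leq_bigmax_cond.
exists (fun x => if x == v then m else l x); split.
  move=> x y; rewrite !inE; case: (eqVneq x v) => [->|nx] /=; case: (eqVneq y v) => [->|ny] //=.
  - by move=> _ /lm; lia.
  - by move=> /lm; lia.
  exact: inj.
move=> x y; rewrite !inE; case: (eqVneq x v) => [->|nx] /=; case: (eqVneq y v) => [->|ny] //=.
- by move=> _ yT _; rewrite dom.
- by move=> xT _ _; rewrite S dom.
exact: lE.
Qed.

(** Exchanges the neighbours of [x] and [y] within [Z], a bulk version of a chain of switches. *)
Definition row_swap G (x y : V) (Z : {set V}) : rel V := fun p q =>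
  if p \in Z then G p (tperm x y q) else if q \in Z then G (tperm x y p) q else G p q.

Lemma row_swap_spec G x y (Z : {set V}) : sgraph G -> x \notin Z -> y \notin Z ->
  #|nb G x :&: Z| = #|nb G y :&: Z| ->
  sgraph (row_swap G x y Z) /\ dg (row_swap G x y Z) =1 dg G.
Proof.
move=> [S I] xZ yZ card.
have tpZ p : p \in Z -> tperm x y p = p.
  by move=> pZ; rewrite tpermD //; [apply: contraNneq xZ|apply: contraNneq yZ] => ->.
split.
  split=> [p q|p]; rewrite /row_swap.
    by case: ifP => pZ; case: ifP => qZ //; rewrite ?(tpZ p) ?(tpZ q) // S.
  by case: (boolP (p \in Z)) => pZ; rewrite ?(tpZ p pZ) I.
have row p : p \notin Z -> nb (row_swap G x y Z) p =
    (nb G p :\: Z) :|: (nb G (tperm x y p) :&: Z).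
  move=> pZ; apply/setP => q; rewrite !inE /row_swap (negbTE pZ).
  by case: (q \in Z); rewrite /= ?andbT ?andbF ?orbF.
have cE A B : #|(A :\: Z) :|: (B :&: Z)| = #|A :\: Z| + #|B :&: Z|.
  rewrite cardsU (_ : (A :\: Z) :&: (B :&: Z) = set0) ?cards0 ?subn0 //.
  by apply/setP => q; rewrite !inE; case: (q \in Z); rewrite /= ?andbF.
move=> p; rewrite /dg; have [pZ|pZ] := boolP (p \in Z).
  rewrite -(card_imset (mem (nb G p)) (@perm_inj _ (tperm x y))).
  apply: eq_card => q; rewrite inE /row_swap pZ; apply/idP/imsetP.
    by move=> g; exists (tperm x y q); rewrite ?tpermK // inE.
  by move=> [q']; rewrite inE => g ->; rewrite tpermK.
rewrite row // cE -(cardsID Z (nb G p)) addnC; congr (_ + _).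
by case: tpermP => [->|->|//]; rewrite card.
Qed.

(** As [y] has at least as many private neighbours as [x], the vertices of [T] that only [x] sees
    can be exchanged for equally many that only [y] sees. Afterwards [y] sees all that [x] saw in
    the rest of [T], so it can inherit the label of [x]. *)
Lemma good_move G T x y : sgraph G -> x \in T -> y \notin T -> dg G x <= dg G y ->
  good G T -> exists G', [/\ sgraph G', dg G' =1 dg G & good G' (y |: T :\ x)].
Proof.
move=> sG xT yT le [l [inj lE]]; have [S I] := sG.
pose X := [set t in T | G x t && ~~ G y t].
pose Y0 := (nb G y :\: nb G x) :\ x.
have leXY : #|X| <= #|Y0|.
  have: #|X| <= #|(nb G x :\: nb G y) :\ y|.
    apply/subset_leq_card/subsetP => t; rewrite !inE => /and3P[tT -> ->].
    by rewrite !andbT; apply: contraNneq yT => <-.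
  have := cardsD1 x (nb G y :\: nb G x); have := cardsD1 y (nb G x :\: nb G y).
  rewrite !inE !I /= (S y x); have := cardsID (nb G y) (nb G x); have := cardsID (nb G x) (nb G y).
  by rewrite -/Y0 (setIC (nb G y)); rewrite /dg in le; lia.
have [Y1 sY cY] := subset_of_card leXY.
have Y1E t : t \in Y1 -> [&& t != x, ~~ G x t & G y t].
  by move/(subsetP sY); rewrite !inE.
have xZ : x \notin X :|: Y1.
  by rewrite !inE I andbF /=; apply/negP => /Y1E; rewrite eqxx.
have yZ : y \notin X :|: Y1.
  by rewrite !inE (negbTE yT) /=; apply/negP => /Y1E; rewrite I !andbF.
have cZ : #|nb G x :&: (X :|: Y1)| = #|nb G y :&: (X :|: Y1)|.
  have -> : nb G x :&: (X :|: Y1) = X.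
    apply/setP => t; rewrite !inE; case: (boolP (t \in Y1)) => [/Y1E/and3P[_ /negbTE-> _]|_].
      by rewrite !andbF.
    by rewrite orbF; case: (G x t); rewrite ?andbF.
  have -> : nb G y :&: (X :|: Y1) = Y1.
    apply/setP => t; rewrite !inE; case: (boolP (t \in Y1)) => [/Y1E/and3P[_ _ ->]|_].
      by rewrite orbT.
    by rewrite orbF; case: (G y t); rewrite ?andbF.
  by rewrite cY.
have [s' d'] := row_swap_spec sG xZ yZ cZ.
exists (row_swap G x y (X :|: Y1)); split=> //.
have ny : y != x by apply: contraNneq yT => ->.
have tl t : t \in T :\ x -> tperm x y t = t.
  by rewrite !inE => /andP[tx tT]; rewrite tpermD // eq_sym //; apply: contraNneq yT => <-.
have tT t : t \in y |: T :\ x -> tperm x y t \in T.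
  rewrite in_setU1 => /orP[/eqP->|h]; first by rewrite tpermR.
  by rewrite tl //; move: h; rewrite inE => /andP[].
have old p q : p \in T :\ x -> q \in T :\ x -> row_swap G x y (X :|: Y1) p q = G p q.
  by move=> pT qT; rewrite /row_swap !tl // if_same; case: ifP.
have new t : t \in T :\ x -> G x t -> row_swap G x y (X :|: Y1) y t.
  rewrite /row_swap (negbTE yZ) tpermR => h gxt; case: ifP => // /negbT.
  move: h; rewrite !inE gxt /= => /andP[tx ->] /=.
  by rewrite negb_or negbK => /andP[].
exists (fun t => l (tperm x y t)); split.
  by move=> p q /tT hp /tT hq /(inj _ _ hp hq)/perm_inj.
move=> p q pT qT npq ng; apply: lE; rewrite ?tT // ?(inj_eq perm_inj) //.
move: pT qT; rewrite !in_setU1 => /orP[/eqP pE|pT] /orP[/eqP qE|qT].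
- by rewrite pE qE eqxx in npq.
- rewrite pE tpermR tl //; apply: contra ng; rewrite pE; exact: new.
- rewrite qE tpermR tl // S; apply: contra ng; rewrite qE s'.1; exact: new.
- by rewrite !tl // -old.
Qed.

Lemma sum_nbI G A B : symmetric G ->
  \sum_(x in A) #|nb G x :&: B| = \sum_(x in B) #|nb G x :&: A|.
Proof.
move=> S; have E D E' : \sum_(x in D) #|nb G x :&: E'| = \sum_(x in D) \sum_(y in E') (G x y : nat).
  apply: eq_bigr => x _; rewrite -sum1_card big_mkcond [RHS]big_mkcond.
  by apply: eq_bigr => y _; rewrite !inE; case: (y \in E'); case: (G x y).
by rewrite !E exchange_big; apply: eq_bigr => y _; apply: eq_bigr => x _; rewrite S.
Qed.

Lemma dg_split G A x : dg G x = #|nb G x :&: A| + #|nb G x :\: A|.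
Proof. by rewrite /dg -(cardsID A (nb G x)). Qed.

(** Both ends of an edge between [A] and its complement are charged to the outer end. Thus an outer
    vertex [x] accounts for [#|nb G x :&: A| + dg G x], the quantity estimated in all later
    counts. *)
Lemma sum_dg_split G A : symmetric G -> \sum_x dg G x =
  \sum_(x in A) #|nb G x :&: A| + \sum_(x in ~: A) (#|nb G x :&: A| + dg G x).
Proof.
move=> S; rewrite (bigID (mem A)) /= big_split /= addnA.
have -> : \sum_(i | i \notin A) dg G i = \sum_(x in ~: A) dg G x.
  by apply: eq_bigl => i; rewrite inE.
congr (_ + _); rewrite (eq_bigr _ (fun x _ => dg_split G A x)) big_split /=; congr (_ + _).
rewrite (@sum_nbI G (~: A) A S); apply: eq_bigr => x _; congr #|pred_of_set _|.
by apply/setP => y; rewrite !inE andbC.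
Qed.

End Good.

(** * Configurations without exchange *)

Section Stuck.
Variable V : finType.
Implicit Types (G : rel V) (A B C K P Y : {set V}).

Lemma dg_sum G x : dg G x = \sum_y (G x y : nat).
Proof.
rewrite /dg -sum1_card big_mkcond; apply: eq_bigr => y _.
by rewrite inE; case: (G x y).
Qed.

Lemma sum_if G A : \sum_x \sum_y ((x \in A) && G x y : nat) = \sum_(x in A) dg G x.
Proof.
rewrite [RHS]big_mkcond; apply: eq_bigr => x _.
by rewrite dg_sum; case: (x \in A) => //; rewrite big1.
Qed.

Lemma sum_if2 G A B :
  \sum_x \sum_y ([&& x \in A, y \in B & G x y] : nat) = \sum_(x in A) #|nb G x :&: B|.
Proof.
rewrite [RHS]big_mkcond; apply: eq_bigr => x _.
case: (x \in A) => /=; last by rewrite big1.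
rewrite -sum1_card [RHS]big_mkcond; apply: eq_bigr => y _.
by rewrite !inE; case: (y \in B); case: (G x y).
Qed.

Lemma sum_flip G (F : V -> V -> bool) : symmetric G ->
  \sum_x \sum_y (F x y && G x y : nat) = \sum_x \sum_y (F y x && G x y : nat).
Proof.
move=> S; rewrite exchange_big; apply: eq_bigr => y _; apply: eq_bigr => x _.
by rewrite S.
Qed.

Lemma nbIC_lt G C x : sgraph G -> x \in C -> #|nb G x :&: C| < #|C|.
Proof.
move=> [_ I] xC; rewrite [X in _ < X](cardsD1 x) xC add1n ltnS.
apply/subset_leq_card/subsetP => y; rewrite !inE => /andP[g ->]; rewrite andbT.
by apply: contraTneq g => ->; rewrite I.
Qed.

Lemma nbIC_lt2 G C x z : sgraph G -> x \in C -> z \in C -> x != z -> ~~ G x z ->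
  #|nb G x :&: C|.+1 < #|C|.
Proof.
move=> [_ I] xC zC nxz ng; rewrite (cardsD1 x C) xC (cardsD1 z (C :\ x)) !inE eq_sym nxz zC.
rewrite !add1n !ltnS; apply/subset_leq_card/subsetP => y; rewrite !inE => /andP[g ->].
by rewrite andbT; apply/andP; split; apply: contraTneq g => ->; rewrite ?I.
Qed.

(** Inside [C] there are at most [r (r + 1) - 2] ordered adjacent pairs, as [uz] is missing. All
    other edges meet [Y] or join [P] to the outside, which gives at most [2 (#|Y| D + #|P| (D + 1))
    <= 2 D^2 + 2 #|P|] more, with [#|P| <= r - 1]. *)
Lemma edge_cover_bound G C P Y u z r D : sgraph G -> u \in C -> z \in C -> u != z ->
  ~~ G u z -> #|C| = r.+1 -> P \subset C -> u \notin P -> z \notin P ->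
  (forall x y, G x y -> x \notin C -> [|| x \in Y, y \in Y | y \in P]) ->
  {in Y, forall y, dg G y <= D} -> {in P, forall c, #|nb G c :\: C| <= D.+1} ->
  #|Y| + #|P| <= D ->
  \sum_x dg G x + 4 <= r * r + 3 * r + 2 * (D * D).
Proof.
move=> sG uC zC nuz nguz cC PC uP zP cover dY dP szD; have [S I] := sG.
have cP : #|P| < r.
  have: P \subset C :\ u :\ z.
    apply/subsetP => p pP; rewrite !inE (subsetP PC) // andbT.
    by apply/andP; split; apply: contraTneq pP => ->.
  move/subset_leq_card; have := cardsD1 u C; have := cardsD1 z (C :\ u).
  by rewrite !inE eq_sym nuz zC uC cC /=; lia.
have inC : \sum_(x in C) #|nb G x :&: C| + 2 <= r * r.+1.
  rewrite (big_setD1 u) //= (big_setD1 z) /=; last by rewrite !inE eq_sym nuz.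
  have b1 := nbIC_lt2 sG uC zC nuz nguz.
  have b2 : #|nb G z :&: C|.+1 < #|C| by apply: (@nbIC_lt2 _ _ z u); rewrite // 1?eq_sym // S.
  have b3 : \sum_(i in C :\ u :\ z) #|nb G i :&: C| <= #|C :\ u :\ z| * r.
    rewrite -sum_nat_const; apply: leq_sum => i; rewrite !inE => /and3P[_ _ iC].
    by have := nbIC_lt sG iC; rewrite cC.
  have := cardsD1 u C; have := cardsD1 z (C :\ u).
  rewrite !inE eq_sym nuz zC uC cC /= => h1 h2; rewrite cC in b1 b2; nia.
have le : \sum_x dg G x <= \sum_x \sum_y ([&& x \in C, y \in C & G x y] +
   ((x \in Y) && G x y + ((y \in Y) && G x y + ([&& x \in P, y \in ~: C & G x y] +
   [&& y \in P, x \in ~: C & G x y])))).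
  apply: leq_sum => x _; rewrite dg_sum; apply: leq_sum => y _; rewrite !inE.
  have [g|//] := boolP (G x y); rewrite !andbT.
  case: (boolP (x \in C)) => xC; case: (boolP (y \in C)) => yC; rewrite /= ?andbT ?andbF //.
  - by have := cover y x; rewrite S g => /(_ isT yC)/or3P[] ->; rewrite ?addn1 ?addnS.
  - by have := cover x y g xC; move=> /or3P[] ->; rewrite ?addn1 ?addnS.
  - have := cover x y g xC; move=> /or3P[] h; rewrite ?h ?addn1 ?addnS //.
have E : forall F1 F2 : V -> V -> nat, \sum_x \sum_y (F1 x y + F2 x y) =
    \sum_x \sum_y F1 x y + \sum_x \sum_y F2 x y.
  by move=> F1 F2; rewrite -big_split; apply: eq_bigr => x _; rewrite big_split.
rewrite !E in le.
have eY : \sum_x \sum_y ((y \in Y) && G x y : nat) = \sum_(x in Y) dg G x.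
  by rewrite -(sum_flip (fun x _ => x \in Y) S) sum_if.
have eP : \sum_x \sum_y ([&& y \in P, x \in ~: C & G x y] : nat) =
    \sum_(x in P) #|nb G x :&: ~: C|.
  rewrite -sum_if2; transitivity (\sum_x \sum_y ((y \in P) && (x \in ~: C) && G x y : nat)).
    by apply: eq_bigr => x _; apply: eq_bigr => y _; rewrite andbA.
  rewrite -(sum_flip (fun x y => (x \in P) && (y \in ~: C)) S).
  by apply: eq_bigr => x _; apply: eq_bigr => y _; rewrite andbA.
rewrite eY eP !sum_if2 (sum_if G Y) in le.
have bY : \sum_(x in Y) dg G x <= #|Y| * D by rewrite -sum_nat_const; apply: leq_sum.
have bP : \sum_(x in P) #|nb G x :&: ~: C| <= #|P| * D.+1.
  by rewrite -sum_nat_const; apply: leq_sum => x xP; rewrite -setDE; apply: dP.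
have b : #|Y| * D + #|P| * D.+1 <= D * D + (r - 1) by nia.
by lia.
Qed.

Section Config.
Variables (G : rel V) (C : {set V}) (u z : V).
Hypotheses (sG : sgraph G) (uC : u \in C) (zC : z \in C) (nuz : u != z).
Hypothesis stuck : ~ addable G C u z.

Lemma stuck_nadj : ~~ G u z.
Proof. by apply/negP => g; apply: stuck; exists G; split. Qed.

Lemma stuck_complete w b : G u w -> w \notin C -> G z b -> b \notin C -> w != b -> G w b.
Proof.
move=> guw wC gzb bC nwb; apply/negPn/negP => ng; apply: stuck.
exact: (exchange2 sG nuz stuck_nadj guw wC gzb bC nwb ng).
Qed.

Lemma stuck_edge w b x y : G u w -> w \notin C -> G z b -> b \notin C ->
  G x y -> x \notin C \/ y \notin C -> (x == w) || G w x || (y == b) || G b y.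
Proof.
move=> guw wC gzb bC gxy oC; apply/negPn/negP; rewrite !negb_or => /andP[/andP[/andP[n1 n2] n3] n4].
exact/stuck/(exchange3 sG uC zC nuz stuck_nadj guw wC gzb bC gxy oC).
Qed.

(* A non-edge in each of the two outer neighbourhoods would allow [exchange3]. *)
Lemma stuck_clique r : r <= #|nb G u :\: C| -> r <= #|nb G z :\: C| ->
  exists2 K : {set V}, #|K| = r.+1 & {in K &, forall x y, x != y -> G x y}.
Proof.
move=> hW hB; have [S I] := sG.
have addv v A : v \notin A -> r <= #|A| -> {in A, forall a, G v a} ->
    {in A &, forall x y, x != y -> G x y} ->
    exists2 K : {set V}, #|K| = r.+1 & {in K &, forall x y, x != y -> G x y}.
  move=> vA /subset_of_card[B sB cB] dom cl; exists (v |: B).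
    by rewrite cardsU1 cB (contra (subsetP sB v)).
  move=> x y; rewrite !inE => /orP[/eqP->|xB] /orP[/eqP->|yB] nxy.
  - by rewrite eqxx in nxy.
  - by apply: dom; apply: (subsetP sB).
  - by rewrite S; apply: dom; apply: (subsetP sB).
  - by apply: cl => //; apply: (subsetP sB).
have [cl|ncl] := classic {in nb G u :\: C &, forall x y, x != y -> G x y}.
  apply: (addv u (nb G u :\: C)) => //; first by rewrite !inE uC.
  by move=> a; rewrite !inE => /andP[].
apply: (addv z (nb G z :\: C)) => //; first by rewrite !inE zC.
  by move=> a; rewrite !inE => /andP[].
move=> b1 b2; rewrite !inE => /andP[b1C gb1] /andP[b2C gb2] nb12.
apply/negPn/negP => ngb; apply: ncl => w1 w2; rewrite !inE => /andP[w1C gw1] /andP[w2C gw2] nw12.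
apply/negPn/negP => ngw.
(* A vertex in both outer neighbourhoods is adjacent to all others there by [stuck_complete]. So
   [w2] and [b2] differ, and the edge [w2 b2] can be fed to [stuck_edge]. *)
have nwb w b w' b' : G u w -> w \notin C -> G u w' -> w' \notin C -> w != w' -> ~~ G w w' ->
   G z b -> b \notin C -> G z b' -> b' \notin C -> w != b.
  move=> guw wC guw' w'C nww ngww gzb bC gzb' b'C; apply/eqP => E; subst w.
  by move/negP: ngww; apply; rewrite S; apply: stuck_complete; rewrite // eq_sym.
have n22 : w2 != b2.
  by apply: (nwb _ _ w1 b1) => //; rewrite 1?eq_sym // S.
have := stuck_edge gw1 w1C gb1 b1C (stuck_complete gw2 w2C gb2 b2C n22) (or_introl w2C).
by rewrite (negbTE ngw) (negbTE ngb) (eq_sym w2) (negbTE nw12) (eq_sym b2) (negbTE nb12).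
Qed.

Variables (r : nat).
Hypotheses (cC : #|C| = r.+1) (umax : forall x, dg G x <= dg G u)
  (outC : forall y, y \notin C -> dg G y <= dg G z) (rz : r <= dg G z).

Lemma stuck_out_pos : (exists w, G u w && (w \notin C)) /\ (exists b, G z b && (b \notin C)).
Proof.
have [S I] := sG.
have b1 := nbIC_lt2 sG uC zC nuz stuck_nadj.
have b2 : #|nb G z :&: C|.+1 < #|C|.
  by apply: (@nbIC_lt2 _ _ z u); rewrite // 1?eq_sym // S stuck_nadj.
have := dg_split G C u; have := dg_split G C z; have := umax z; rewrite cC in b1 b2 => h1 h2 h3.
split.
  have /card_gt0P [w] : 0 < #|nb G u :\: C| by lia.
  by rewrite !inE andbC => h; exists w.
have /card_gt0P [w] : 0 < #|nb G z :\: C| by lia.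
by rewrite !inE andbC => h; exists w.
Qed.

(** An outer neighbour [b] of [z] is adjacent to [z] and to every outer neighbour of [u] other than
    itself. So [u] has fewer than [dg b <= dg z] outer neighbours, besides at most [r - 1] in
    [C]. *)
Lemma stuck_max_le : dg G u + 2 <= dg G z + r.
Proof.
have [S I] := sG.
have [_ [b /andP[gzb bC]]] := stuck_out_pos.
have b1 := nbIC_lt2 sG uC zC nuz stuck_nadj; have := dg_split G C u; rewrite cC in b1.
suff: #|nb G u :\: C| < dg G b by have := outC bC; lia.
have sub : z |: (nb G u :\: C) :\ b \subset nb G b.
  apply/subsetP => x; rewrite !inE => /orP[/eqP->|/and3P[xb xC gux]]; first by rewrite S.
  by rewrite S; apply: stuck_complete.
have zn : z \notin (nb G u :\: C) :\ b by rewrite !inE zC andbF.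
have [gub|ngub] := boolP (G u b).
  have /subset_leq_card : u |: (z |: (nb G u :\: C) :\ b) \subset nb G b.
    by rewrite subUset sub sub1set inE S gub.
  rewrite cardsU1 !inE (negbTE nuz) I !andbF /= cardsU1 zn [#|nb G u :\: C|](cardsD1 b) !inE gub bC.
  by rewrite /dg; lia.
move/subset_leq_card: sub; rewrite cardsU1 zn [#|nb G u :\: C|](cardsD1 b) !inE (negbTE ngub) andbF.
by rewrite /dg; lia.
Qed.

(** In the application [C] is a pattern with the vertex [u] added: [c] misses at most two vertices
    of the pattern, and perhaps [u]. *)
Hypothesis inner : forall c, c \in C -> c != u -> c != z -> r <= #|nb G c :&: C| + 3.

Lemma stuck_inner c : c \in C -> c != u -> c != z -> #|nb G c :\: C| <= (dg G z).+1.
Proof.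
move=> c0 c1 c2; have := inner c0 c1 c2; have := stuck_max_le.
by have := umax c; rewrite (dg_split G C c); lia.
Qed.

Lemma stuck_bound_common w : G u w -> G z w -> w \notin C ->
  \sum_x dg G x + 4 <= r * r + 3 * r + 2 * (dg G z * dg G z).
Proof.
move=> guw gzw wC; have [S I] := sG.
apply: (@edge_cover_bound G C (nb G w :&: C :\ u :\ z) ((w |: nb G w) :\: C) u z) => //.
- exact: stuck_nadj.
- by apply/subsetP => x; rewrite !inE => /and3P[_ _ /andP[]].
- by rewrite !inE eqxx andbF.
- by rewrite !inE eqxx.
- move=> x y gxy xC; have /orP[/orP[/orP[|]|]|] := stuck_edge guw wC gzw wC gxy (or_introl xC).
  + by move=> /eqP->; rewrite !inE eqxx wC.
  + by move=> g; rewrite !inE xC g orbT.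
  + by move=> /eqP->; rewrite !inE eqxx wC orbT.
  move=> g; have [yC|yC] := boolP (y \in C); last by rewrite !inE yC g !orbT.
  have [yz|yz] := eqVneq y z.
    have [->|nxw] := eqVneq x w; first by rewrite !inE eqxx wC.
    have : G w x by apply: stuck_complete; rewrite // 1?eq_sym // S -yz.
    by move=> gwx; rewrite !inE xC gwx orbT.
  have [yu|yu] := eqVneq y u.
    have [->|nxw] := eqVneq x w; first by rewrite !inE eqxx wC.
    have : G x w by apply: stuck_complete; rewrite // S -yu.
    by rewrite S => gwx; rewrite !inE xC gwx orbT.
  by rewrite !inE yC yz yu g !orbT.
- by move=> y; rewrite inE => /andP[yC _]; apply: outC.
- by move=> c; rewrite !inE => /and3P[cz cu /andP[_ c0]]; apply: stuck_inner.
have h1 : #|(w |: nb G w) :\: C| = (#|nb G w :\: C|).+1.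
  rewrite setDUl (setDidPl _) ?disjoints1 // cardsU1 !inE I andbF //.
have h2 := cardsD1 u (nb G w :&: C); have h3 := cardsD1 z (nb G w :&: C :\ u).
move: h2 h3; rewrite !inE !(S w) guw gzw uC zC eq_sym nuz /=.
by have := dg_split G C w; have := outC wC; move: h1; clear; lia.
Qed.

(** The closed neighbourhoods of [w] and [b] agree up to [u] and [z], so that of [w] serves for
    both. Only [u] is dropped from it, as [z] is not in it; the size is still at most [dg z]. *)
Lemma stuck_bound_twin w b : G u w -> ~~ G z w -> w \notin C -> G z b -> ~~ G u b -> b \notin C ->
  (forall x, G w x -> x != u -> (x == b) || G b x) ->
  (forall x, G b x -> x != z -> (x == w) || G w x) ->
  \sum_x dg G x + 4 <= r * r + 3 * r + 2 * (dg G z * dg G z).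
Proof.
move=> guw ngzw wC gzb ngub bC tw tb; have [S I] := sG.
have nwb : w != b by apply: contraNneq ngzw => ->.
have gwb : G w b by apply: stuck_complete.
have nzw : z != w by apply: contraNneq wC => <-.
apply: (@edge_cover_bound G C (nb G w :&: C :\ u) ((w |: nb G w) :\: C) u z) => //.
- exact: stuck_nadj.
- by apply/subsetP => x; rewrite !inE => /and3P[_ _].
- by rewrite !inE eqxx.
- by rewrite !inE (S w) (negbTE ngzw) andbF.
- have outW x : G u x -> x \notin C -> x \in (w |: nb G w) :\: C.
    move=> gux xC; rewrite !inE xC /=; have [xb|nxb] := eqVneq x b; first by rewrite xb gwb orbT.
    apply: tb; last by apply: contraNneq xC => ->.
    by rewrite S; apply: stuck_complete.
  have outB x : G z x -> x \notin C -> x \in (w |: nb G w) :\: C.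
    move=> gzx xC; rewrite !inE xC /=; have [//|nxw] := eqVneq x w.
    by apply: stuck_complete; rewrite // eq_sym.
  have key x y : G x y -> y \notin C -> (x == w) || G w x ->
      (y \in (w |: nb G w) :\: C) || (x \in (w |: nb G w) :\: C) || (x \in nb G w :&: C :\ u).
    move=> gxy yC h; have [xC|xC] := boolP (x \in C); last by rewrite !inE xC h orbT.
    have [xu|xu] := eqVneq x u; first by rewrite outW // -xu.
    have nxw : x != w by apply: contraNneq wC => <-.
    by rewrite (negbTE nxw) /= in h; rewrite !inE xC xu h !orbT.
  have key2 x : x \notin C -> (x == w) || G w x -> x \in (w |: nb G w) :\: C.
    by move=> xC h; rewrite !inE xC.
  move=> x y gxy xC.
  have /orP[/orP[h|]|] := stuck_edge guw wC gzb bC gxy (or_introl xC).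
  + by rewrite key2.
  + by move=> /eqP->; rewrite !inE gwb bC !orbT.
  move=> gby; have [yz|yz] := eqVneq y z; first by rewrite outB // S -yz.
  have := key y x; rewrite S gxy xC tb // => /(_ isT isT isT).
  by rewrite -orbA.
- by move=> y; rewrite inE => /andP[yC _]; apply: outC.
- move=> c; rewrite !inE => /and3P[cu gwc c0]; apply: stuck_inner => //.
  by apply: contraTneq gwc => ->; rewrite S.
have h1 : #|(w |: nb G w) :\: C| = (#|nb G w :\: C|).+1.
  by rewrite setDUl (setDidPl _) ?disjoints1 // cardsU1 !inE I andbF.
have h2 := cardsD1 u (nb G w :&: C).
move: h2; rewrite !inE !(S w) guw uC /=.
by have := dg_split G C w; have := outC wC; move: h1; clear; lia.
Qed.

End Config.

Lemma stuck_bound G C u z r : sgraph G -> u \in C -> z \in C -> u != z -> ~ addable G C u z ->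
  #|C| = r.+1 -> (forall x, dg G x <= dg G u) -> (forall y, y \notin C -> dg G y <= dg G z) ->
  r <= dg G z ->
  (forall c, c \in C -> c != u -> c != z -> r <= #|nb G c :&: C| + 3) ->
  \sum_x dg G x + 4 <= r * r + 3 * r + 2 * (dg G z * dg G z).
Proof.
move=> sG uC zC nuz stuck cC umax outC rz inner; have [S I] := sG.
have [[w /andP[guw wC]] [b /andP[gzb bC]]] :=
  stuck_out_pos sG uC zC nuz stuck cC umax rz.
have [gzw|ngzw] := boolP (G z w).
  exact: (stuck_bound_common sG uC zC nuz stuck cC umax outC rz inner guw gzw).
have [gub|ngub] := boolP (G u b).
  exact: (stuck_bound_common sG uC zC nuz stuck cC umax outC rz inner gub gzb).
have nwb : w != b by apply: contraNneq ngzw => ->.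
(* The bound depends on degrees only, so it may be proved in any realization that keeps the edges
   inside [C]; all hypotheses persist there. *)
have transfer G' : sgraph G' -> dg G' =1 dg G -> {in C &, forall x y, G x y -> G' x y} ->
    (exists2 w', G' u w' & G' z w' && (w' \notin C)) ->
    \sum_x dg G x + 4 <= r * r + 3 * r + 2 * (dg G z * dg G z).
  move=> s' d' c' [w' g1 /andP[g2 w'C]].
  have st' : ~ addable G' C u z by apply: contra_not stuck; apply: addable_trans.
  have um' x : dg G' x <= dg G' u by rewrite !d'.
  have oc' y : y \notin C -> dg G' y <= dg G' z by rewrite !d'; apply: outC.
  have rz' : r <= dg G' z by rewrite d'.
  have inn' c : c \in C -> c != u -> c != z -> r <= #|nb G' c :&: C| + 3.
    move=> c0 c1 c2; apply: leq_trans (inner c c0 c1 c2) _; rewrite leq_add2r.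
    apply/subset_leq_card/subsetP => y; rewrite !inE => /andP[g yC]; rewrite yC andbT.
    exact: c'.
  have := stuck_bound_common s' uC zC nuz st' cC um' oc' rz' inn' g1 g2 w'C.
  by rewrite d' (eq_bigr _ (fun x _ => d' x)).
have nuw : u != w by apply: contraNneq wC => <-.
have nzb : z != b by apply: contraNneq bC => <-.
have nzw : z != w by apply: contraNneq wC => <-.
have nub : u != b by apply: contraNneq bC => <-.
(* If [w] and [b] are not twins, some [x] sees just one of them, and a switch through [x] creates a
   common outer neighbour of [u] and [z]. *)
have [/existsP[x /and4P[gwx xu xb ngbx]]|no1] :=
    boolP [exists x, [&& G w x, x != u, x != b & ~~ G b x]].
  have gxw : G x w by rewrite S.
  have ngxb : ~~ G x b by rewrite S.
  have nxz : x != z by apply: contraNneq ngzw => <-.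
  have [s' d'] := switch_spec sG gzb gxw nzw xb ngzw ngxb.
  apply: (transfer _ s' d'); first by apply: switch_in; right.
  exists w; last by rewrite /switch /same_pair !eqxx.
  rewrite /switch guw /same_pair (negbTE nuz) (negbTE nuw) (negbTE nub) (eq_sym u x) (negbTE xu).
  by rewrite (negbTE nwb) /= ?andbF ?orbT.
have [/existsP[x /and4P[gbx xz xw ngwx]]|no2] :=
    boolP [exists x, [&& G b x, x != z, x != w & ~~ G w x]].
  have gxb : G x b by rewrite S.
  have ngxw : ~~ G x w by rewrite S.
  have nxu : x != u by apply: contraNneq ngub => <-.
  have [s' d'] := switch_spec sG guw gxb nub xw ngub ngxw.
  apply: (transfer _ s' d'); first by apply: switch_in; right.
  exists b; first by rewrite /switch /same_pair !eqxx.
  rewrite bC andbT /switch gzb /same_pair (eq_sym z u) (negbTE nuz) (negbTE nzw) (negbTE nzb) (eq_sym z x) (negbTE xz).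
  by rewrite /= ?andbF ?orbT.
apply: (@stuck_bound_twin G C u z sG uC zC nuz stuck r cC umax outC rz inner w b) => //.
  move=> x gwx xu; apply/negPn/negP; rewrite negb_or => /andP[xb ng].
  by case/negP: no1; apply/existsP; exists x; rewrite gwx xu xb.
move=> x gbx xz; apply/negPn/negP; rewrite negb_or => /andP[xb ng].
by case/negP: no2; apply/existsP; exists x; rewrite gbx xz xb.
Qed.

End Stuck.

(** * Removing a vertex of maximum degree *)

Section Peel.
Variable V : finType.
Implicit Types (G : rel V) (A B C K T U : {set V}).

(* The bound [r + 42] is only effective for [r < 6]: it is what remains of [n >= 5 r + 18]
   when the induction descends from some [r >= 6]. *)
Definition attains r := forall G U, sgraph G -> (forall x y, G x y -> x \in U) ->
  5 * r + 18 <= #|U| -> r + 42 <= #|U| ->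
  2 * r * #|U| + 4 * r <= \sum_x dg G x + r * r + 1 + 5 * #|U| ->
  exists G' C, [/\ sgraph G', dg G' =1 dg G, C \subset U, #|C| = r.+1 & good G' C].

Lemma good_mono G G' T : {in T &, forall x y, G x y -> G' x y} -> good G T -> good G' T.
Proof.
move=> mono [l [inj lE]]; exists l; split=> // x y xT yT nxy ng.
by apply: lE => //; apply: contra ng; apply: mono.
Qed.

(** The vertex [v] remains as an isolated point, so the type [V] is the same throughout the
    induction; the shrinking vertex set is the support [U] in [attains]. *)
Definition del_vertex G v : rel V := fun x y => [&& G x y, x != v & y != v].

Lemma del_vertex_sgraph G v : sgraph G -> sgraph (del_vertex G v).
Proof.
move=> [S I]; split=> [x y|x]; rewrite /del_vertex ?I //.
by rewrite S; case: (x != v); case: (y != v); rewrite ?andbF.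
Qed.

Lemma del_vertex_dg G v x : sgraph G -> x != v -> dg G x = dg (del_vertex G v) x + G v x.
Proof.
move=> [S I] nx; rewrite /dg (cardsD1 v) in_nb addnC (S x); congr (_ + _).
by apply: eq_card => y; rewrite !inE /del_vertex nx andbC.
Qed.

Lemma del_vertex_dgv G v : dg (del_vertex G v) v = 0.
Proof. by apply/eqP; rewrite cards_eq0; apply/eqP/setP => y; rewrite !inE /del_vertex eqxx andbF. Qed.

Lemma del_vertex_sum G v : sgraph G ->
  \sum_x dg G x = \sum_x dg (del_vertex G v) x + 2 * dg G v.
Proof.
move=> sG; have [S I] := sG.
rewrite (bigD1 v) // [in RHS](bigD1 v) //= del_vertex_dgv add0n.
rewrite (eq_bigr _ (fun x nx => del_vertex_dg sG nx)) big_split /=.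
suff -> : \sum_(i | i != v) (G v i : nat) = dg G v by lia.
by rewrite dg_sum [RHS](bigD1 v) //= I add0n.
Qed.

Definition add_vertex G1 G v : rel V :=
  fun x y => [|| G1 x y, (x == v) && G v y | (y == v) && G v x].

Lemma add_vertex_spec G1 G v : sgraph G -> sgraph G1 -> dg G1 =1 dg (del_vertex G v) ->
  [/\ sgraph (add_vertex G1 G v), dg (add_vertex G1 G v) =1 dg G &
      forall x, add_vertex G1 G v v x = G v x].
Proof.
move=> sG s1 d1; have [S I] := sG; have [S1 I1] := s1.
have iso y : G1 v y = false.
  have := d1 v; rewrite del_vertex_dgv /dg => /eqP; rewrite cards_eq0 => /eqP/setP/(_ y).
  by rewrite !inE.
have sy : symmetric (add_vertex G1 G v).
  by move=> x y; rewrite /add_vertex S1; congr (_ || _); rewrite orbC.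
have vE x : add_vertex G1 G v v x = G v x.
  by rewrite /add_vertex iso eqxx I andbF orbF.
split=> //.
  split=> // x; rewrite /add_vertex I1 /= orbb.
  by case: eqVneq => //= ->; rewrite I.
move=> x; case: (eqVneq x v) => [->|nx].
  by apply: eq_card => y; rewrite !inE vE.
rewrite (del_vertex_dg sG nx) -d1 /dg (cardsD1 v) in_nb sy vE addnC; congr (_ + _).
apply: eq_card => y; rewrite !inE /add_vertex (negbTE nx) /=.
by case: (eqVneq y v) => [->|ny] /=; rewrite ?orbF // S1 iso.
Qed.

Lemma key_arith a b (c : bool) : 2 * a + c <= 2 * b + false -> a + c <= b + false.
Proof. by case: c; lia. Qed.

Lemma peel_step r : 2 <= r -> attains r -> forall G U, sgraph G ->
  (forall x y, G x y -> x \in U) ->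
  5 * r.+1 + 18 <= #|U| -> r.+1 + 42 <= #|U| ->
  2 * r.+1 * #|U| + 4 * r.+1 <= \sum_x dg G x + r.+1 * r.+1 + 1 + 5 * #|U| ->
  r.+1 < #|[set x | r < dg G x]| ->
  exists G' C, [/\ sgraph G', dg G' =1 dg G, C \subset U, #|C| = r.+2 & good G' C].
Proof.
move=> r2 IH G U sG inU U5 U42 sum many; have [S I] := sG.
have /card_gt0P [v0 v0P] : 0 < #|[set x | r < dg G x]| by lia.
have [v _ vmax] := @arg_maxnP V v0 predT (dg G) isT.
have umax x : dg G x <= dg G v by apply: vmax.
have vdeg : r < dg G v by apply: leq_trans (umax v0); rewrite inE in v0P.
have dgU x : 0 < dg G x -> x \in U.
  by move=> /card_gt0P [y]; rewrite inE; apply: inU.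
have vU : v \in U by apply: dgU; lia.
have cU := cardsD1 v U; rewrite vU /= in cU.
have dvU : dg G v < #|U|.
  rewrite cU add1n ltnS; apply/subset_leq_card/subsetP => y; rewrite !inE => g.
  by rewrite (inU y v) 1?S // andbT; apply: contraTneq g => ->; rewrite I.
set Gv := del_vertex G v.
have [G0 [T0 init]] : exists G' C, [/\ sgraph G', dg G' =1 dg Gv, C \subset U :\ v, #|C| = r.+1 & good G' C].
  apply: IH; try lia.
  - exact: del_vertex_sgraph.
  - by move=> x y /and3P[g nx _]; rewrite !inE nx (inU x y).
  by move: sum; have := del_vertex_sum v sG; rewrite -/Gv cU; lia.
(* Ties in [G - v] are broken in favour of the neighbours of [v]: then no vertex outside
   [v |: T] has a larger degree in [G] than a non-neighbour of [v] in [T]. *)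
pose key x := 2 * dg Gv x + G v x.
have [|[G1 T] /= [s1 d1 TU cT g1] Tmax] := @max_exists (rel V * {set V})
    (fun p => [/\ sgraph p.1, dg p.1 =1 dg Gv, p.2 \subset U :\ v, #|p.2| = r.+1 & good p.1 p.2])
    (fun p => \sum_(x in p.2) key x) (\sum_x key x) (ex_intro _ (G0, T0) init).
  by move=> [p1 p2] _ /=; rewrite [X in _ <= X](bigID (mem p2)) /= leq_addr.
have keyle x y : x \in T -> y \in U :\ v -> y \notin T -> key y <= key x.
  move=> xT yU yT; rewrite leqNgt; apply/negP => lt.
  have le : dg G1 x <= dg G1 y.
    by rewrite !d1; move: lt; rewrite /key; case: (G v x); case: (G v y); lia.
  have [G2 [s2 d2 g2]] := good_move s1 xT yT le g1.
  have yTx : y \notin T :\ x by rewrite !inE (negbTE yT) andbF.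
  have hP : [/\ sgraph G2, dg G2 =1 dg Gv, y |: T :\ x \subset U :\ v,
      #|y |: T :\ x| = r.+1 & good G2 (y |: T :\ x)].
    split=> //; first by move=> p; rewrite d2 d1.
      by rewrite subUset sub1set yU (subset_trans (subsetDl _ _)).
    by rewrite cardsU1 yTx; have := cardsD1 x T; rewrite xT cT; lia.
  have := Tmax (G2, y |: T :\ x) hP; rewrite /= big_setU1 //= [X in _ <= X](big_setD1 x) //=.
  by lia.
have vT : v \notin T by apply/negP => /(subsetP TU); rewrite !inE eqxx.
have [s2 d2 G2v] := add_vertex_spec sG s1 d1.
set G2 := add_vertex G1 G v in s2 d2 G2v.
pose C := v |: T.
have cC : #|C| = r.+2 by rewrite cardsU1 vT cT.
have vC : v \in C by rewrite !inE eqxx.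
have CU : C \subset U by rewrite subUset sub1set vU (subset_trans TU) // subsetDl.
have [||G3 /= [s3 d3 c3] G3max] := @max_exists (rel V)
    (fun H => [/\ sgraph H, dg H =1 dg G & {in C &, forall x y, G2 x y -> H x y}])
    (fun H => #|nb H v :&: T|) #|T|.
- by exists G2; split.
- by move=> H _; apply/subset_leq_card/subsetIr.
have TC x : x \in T -> x \in C by move=> xT; rewrite !inE xT orbT.
have g3 : good G3 T.
  apply: good_mono g1 => x y xT yT g; apply: c3; rewrite ?TC //.
  by rewrite /G2 /add_vertex g.
have [dom|ndom] := classic {in T, forall x, G3 v x}.
  by exists G3, C; split=> //; apply: good_addv => //; exact: s3.1.
have [z zT nvz] : exists2 z, z \in T & ~~ G3 v z.
  apply: NNPP => no; apply: ndom => x xT; apply/negPn/negP => ng.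
  by apply: no; exists x.
have zC := TC z zT.
have nz : v != z by apply: contraNneq vT => ->.
have stuck : ~ addable G3 C v z.
  move=> [G4 [s4 d4 c4 g4]].
  have hP : [/\ sgraph G4, dg G4 =1 dg G & {in C &, forall x y, G2 x y -> G4 x y}].
    by split=> // [x|x y xC yC g]; rewrite ?d4 // c4 // c3.
  have := G3max G4 hP; rewrite leqNgt => /negP; apply; apply: proper_card; apply/properP; split.
    by apply/subsetP => y; rewrite !inE => /andP[g yT]; rewrite yT andbT c4 // TC.
  by exists z; rewrite !inE ?g4 ?zT // (negbTE nvz).
have nGvz : ~~ G v z by apply: contra nvz => g; apply: c3 => //; rewrite G2v.
have dE x : x != v -> dg G x = dg Gv x + G v x by move=> nx; apply: del_vertex_dg.
have out y : y \notin C -> dg G3 y <= dg G3 z.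
  rewrite !inE negb_or => /andP[nyv yT]; rewrite !d3.
  have [yU|nyU] := boolP (y \in U).
    have := keyle z y zT; rewrite !inE nyv yU => /(_ isT yT).
    rewrite /key (negbTE nGvz) (dE y nyv) (dE z); last by rewrite eq_sym.
    by rewrite (negbTE nGvz); exact: key_arith.
  by move: nyU; apply: contraNT; rewrite -ltnNge => h; apply: dgU; apply: leq_ltn_trans h.
have um3 x : dg G3 x <= dg G3 v by rewrite !d3.
(* Otherwise [z] and all vertices outside [C] have degree at most [r], which leaves only the [r + 1]
   vertices of [C :\ z], against [many]. *)
have rz : r.+1 <= dg G3 z.
  rewrite leqNgt; apply/negP => lt.
  have : [set x | r < dg G x] \subset C :\ z.
    apply/subsetP => x; rewrite !inE => h; apply/andP; split.
      by apply: contraTneq h => ->; rewrite -d3 -leqNgt -ltnS.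
    apply/negPn/negP => h2; have := out x; rewrite !inE h2 => /(_ isT); rewrite d3.
    by move: h lt; clear; lia.
  by move/subset_leq_card; have := cardsD1 z C; rewrite zC cC /=; move: many; clear; lia.
(* Each of [v] and [z] has at most [r] neighbours in [C], so degree [2 r + 1] forces [r + 1] outer
   neighbours, as [stuck_clique] requires. *)
have [big|small] := leqP (2 * r + 1) (dg G3 z).
  have nGz : ~~ G3 z v by rewrite s3.1.
  have b1 := nbIC_lt2 s3 vC zC nz nvz; have b2 := @nbIC_lt2 _ _ _ z v s3 zC vC.
  rewrite eq_sym in b2; have {}b2 := b2 nz nGz.
  have := dg_split G3 C v; have := dg_split G3 C z; rewrite cC in b1 b2 => e1 e2.
  have [||K cK clK] := @stuck_clique _ G3 C v z s3 vC zC nz stuck r.+1.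
  - by have := um3 z; move: big b1 e2; clear; lia.
  - by move: big b2 e1; clear; lia.
  exists G3, K; split=> //; last exact: good_clique.
  apply/subsetP => x xK; apply: dgU; rewrite -d3.
  have /card_gt0P [y] : 0 < #|K :\ x| by have := cardsD1 x K; rewrite xK cK; clear; lia.
  rewrite !inE => /andP[nyx yK]; apply/card_gt0P; exists y; rewrite inE.
  by apply: clK => //; rewrite eq_sym.
have inner c : c \in C -> c != v -> c != z -> r.+1 <= #|nb G3 c :&: C| + 3.
  rewrite !inE => /orP[/eqP->|cT'] cv cz; first by rewrite eqxx in cv.
  have h := good_nonadj g3 cT'.
  have : T \subset c |: ((nb G3 c :&: C) :|: [set y in T | (y != c) && ~~ G3 c y]).
    apply/subsetP => y yT; rewrite !inE yT /= orbT andbT.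
    by case: eqVneq => //= _; case: (G3 c y).
  move/subset_leq_card; rewrite cT cardsU1; move/leq_trans; apply.
  by have := (leq_card_setU (nb G3 c :&: C) [set y in T | (y != c) && ~~ G3 c y]).1; case: (_ \notin _) h => /=; clear; lia.
have := stuck_bound s3 vC zC nz stuck cC um3 out rz inner.
rewrite (eq_bigr _ (fun x _ => d3 x)).
move: sum U5 U42 small r2; clear => h1 h2 h3 h4 h5 h6.
(* With [n = #|U|] the two bounds give [(2 r - 3) n <= 10 r^2 + 3 r - 2]. For [r >= 3] this
   contradicts [n >= 5 r + 23]. For [r = 2] it says [n <= 44], while the second size hypothesis
   gives [n >= 45]. *)
have [r3|r3] := leqP 3 r; nia.
Qed.

End Peel.

(** * Few vertices of large degree *)

(** In [open_addable], [i] and [j] count the vertices of [W] inside and outside [C], and [l] is the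
    size of [Nr]. With [e = r - 3 - i], each of the [m] remaining outer vertices loses [2 e + 1]
    against the rate [2 r - 5], while the total gain is at most [3 l + j (r - 1) + 6]; here
    [j <= e], [l <= 2 e + 4] and [m >= 4 i + 2 e + 25]. *)
Lemma tail_arith r n i j l s : i + j + 3 <= r -> l + 2 * i + 2 <= 2 * r ->
  5 * r + 18 <= n -> l + r.+1 <= n ->
  s <= r.+1 * r + l * (2 * (r - 1)) + (n - r.+1 - l) * (2 * i) + j * (r - 1) ->
  2 * r * n + 4 * r <= s + r * r + 1 + 5 * n -> False.
Proof.
move=> h1 h2 h3 h5 h6 h7.
have [e eE] : exists e, r = i + e + 3 by exists (r - i - 3); lia.
have [m mE] : exists m, n = m + r + 1 + l by exists (n - r - 1 - l); lia.
have je : j <= e by lia.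
have le : l <= 2 * e + 4 by lia.
have m0 : 4 * i + 2 * e + 25 <= m by lia.
have a1 : j * (r - 1) <= e * (i + e + 2) by apply: leq_mul; lia.
have a2 : r - 1 = i + e + 2 by lia.
have a3 : n - r.+1 - l = m by lia.
rewrite a3 a2 in h6; rewrite a2 in a1.
have a4 : l * (2 * e) <= (2 * e + 4) * (2 * e) by apply: leq_mul.
have a5 : (2 * e + 1) * (4 * i + 2 * e + 25) <= (2 * e + 1) * m by apply: leq_mul.
have {}h6 := leq_trans h6 (leq_add (leqnn _) a1).
rewrite eE in mE h6 h7; rewrite mE in h7.
clear - h6 h7 a4 a5 le; lia.
Qed.

Section LowTail.
Variable V : finType.
Implicit Types (G : rel V) (A B K T : {set V}).
Variables (U C : {set V}) (r : nat).
Hypotheses (CU : C \subset U) (cC : #|C| = r.+1) (U5 : 5 * r + 18 <= #|U|).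

Definition low_tail G := [/\ sgraph G, forall x y, G x y -> x \in U,
  forall y, y \notin C -> dg G y < r &
  2 * r * #|U| + 4 * r <= \sum_x dg G x + r * r + 1 + 5 * #|U|].

Lemma low_tail_same G G' : sgraph G' -> dg G' =1 dg G -> low_tail G -> low_tail G'.
Proof.
move=> s' d' [s inU lt sum]; split=> // [x y g|y yC|].
- have: 0 < dg G x by rewrite -d'; apply/card_gt0P; exists y; rewrite inE.
  by move=> /card_gt0P [t]; rewrite inE; apply: inU.
- by rewrite d' lt.
by rewrite (eq_bigr _ (fun x _ => d' x)).
Qed.

Lemma card_UD : #|U :\: C| = #|U| - r.+1.
Proof. by rewrite cardsD (setIidPr CU) cC. Qed.

Lemma sum_in G : sgraph G -> \sum_(x in C) #|nb G x :&: C| <= r.+1 * r.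
Proof.
move=> sG; rewrite -cC -sum_nat_const; apply: leq_sum => x xC.
by have := nbIC_lt sG xC; rewrite cC.
Qed.

(** If no exchange exists, [stuck_edge], read in both directions of an edge, shows that an outer
    vertex away from [a] and [b] is adjacent only to common neighbours of [a] and [b]. Apart from
    [u] and [z] there are at most [r - 3] of these, so most outer vertices account for too
    little. *)
Lemma open_addable G u z : low_tail G -> u \in C -> z \in C -> u != z ->
  nb G u :\: C != set0 -> nb G z :\: C != set0 -> addable G C u z.
Proof.
move=> [sG inU lt sum] uC zC nuz /set0Pn [a]; rewrite !inE => /andP[aC gua].
move=> /set0Pn [b]; rewrite !inE => /andP[bC gzb]; apply: NNPP => stuck.
have [S I] := sG.
have complete := stuck_complete sG nuz stuck.
have edge := stuck_edge sG uC zC nuz stuck gua aC gzb bC.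
pose Nr := (a |: nb G a :|: (b |: nb G b)) :\: C.
pose W := nb G a :&: nb G b :\ u :\ z.
have dga := lt a aC; have dgb := lt b bC.
have nrU : Nr \subset U :\: C.
  apply: setSD; apply/subsetP => x; rewrite !inE => /orP[]/orP[/eqP->|g].
  - by apply: (inU _ u); rewrite S.
  - by apply: (inU _ a); rewrite S.
  - by apply: (inU _ z); rewrite S.
  - by apply: (inU _ b); rewrite S.
have restW o : o \notin C -> o \notin Nr -> nb G o \subset W.
  move=> oC; rewrite !inE oC /= !negb_or => /andP[/andP[noa ngao] /andP[nob ngbo]].
  apply/subsetP => y; rewrite !inE => goy.
  have e1 := edge o y goy (or_introl oC).
  have e2 := edge y o; rewrite S goy in e2; have {}e2 := e2 isT (or_intror oC).
  have nyb : y != b by apply: contraNneq ngbo => <-; rewrite S.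
  have nya : y != a by apply: contraNneq ngao => <-; rewrite S.
  rewrite (negbTE noa) (negbTE ngao) (negbTE nyb) /= in e1.
  rewrite (negbTE nob) (negbTE ngbo) (negbTE nya) /= !orbF in e2.
  rewrite e1 e2 !andbT; apply/andP; split.
    apply: contraNneq ngao => yz; apply: complete => //; last by rewrite eq_sym.
    by rewrite -yz S.
  apply: contraNneq ngbo => yu; rewrite S; apply: complete => //.
  by rewrite -yu S.
have cW : #|W| + 2 <= dg G a.
  have [ab|nab] := eqVneq a b.
    have: W \subset nb G a :\ u :\ z.
      by apply/subsetP => y; rewrite !inE => /and4P[-> -> -> _].
    move/subset_leq_card; have := cardsD1 u (nb G a); have := cardsD1 z (nb G a :\ u).
    rewrite !inE !(S a) gua ab gzb eq_sym nuz /dg /=; clear; lia.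
  have nub : u != b by apply: contraNneq bC => <-.
  have: W \subset nb G a :\ u :\ b.
    apply/subsetP => y; rewrite !inE => /and4P[_ -> -> gby]; rewrite !andbT.
    by apply: contraTneq gby => ->; rewrite I.
  move/subset_leq_card; have := cardsD1 u (nb G a); have := cardsD1 b (nb G a :\ u).
  rewrite !inE !(S a) gua (S b) complete // eq_sym nub /dg /=; clear; lia.
have cN x v' : (v' \in C) -> G x v' -> x \notin C -> (v' == u) || (v' == z) -> W \subset nb G x ->
    dg G x < r -> #|(x |: nb G x) :\: C| + #|W :&: C| + 1 <= r.
  move=> v'C gxv xC vuz sW dx.
  have h1 : #|(x |: nb G x) :\: C| = (#|nb G x :\: C|).+1.
    by rewrite setDUl (setDidPl _) ?disjoints1 // cardsU1 !inE I andbF.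
  have: v' |: (W :&: C) \subset nb G x :&: C.
    by rewrite subUset sub1set !inE gxv v'C setSI.
  move/subset_leq_card; rewrite cardsU1 !inE.
  have -> : [&& v' != z, v' != u & G a v' && G b v'] = false.
    by case/orP: vuz => /eqP->; rewrite eqxx ?andbF.
  rewrite /= h1; move: dx; rewrite (dg_split G C x); clear; lia.
have cNr : #|Nr| + 2 * #|W :&: C| + 2 <= 2 * r.
  have := @cN a u uC; rewrite S => /(_ gua aC); rewrite eqxx => /(_ isT _ dga) h1.
  have := @cN b z zC; rewrite S => /(_ gzb bC); rewrite eqxx orbT => /(_ isT _ dgb) h2.
  have {}h1 : #|(a |: nb G a) :\: C| + #|W :&: C| + 1 <= r.
    by apply: h1; apply/subsetP => y; rewrite !inE => /and4P[_ _ ->].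
  have {}h2 : #|(b |: nb G b) :\: C| + #|W :&: C| + 1 <= r.
    by apply: h2; apply/subsetP => y; rewrite !inE => /and4P[_ _ _ ->].
  have := (leq_card_setU ((a |: nb G a) :\: C) ((b |: nb G b) :\: C)).1.
  by rewrite -setDUl -/Nr; move: h1 h2; clear; lia.
have lW := cardsID C W.
have sumO : \sum_(x in ~: C) (#|nb G x :&: C| + dg G x) <=
    #|Nr| * (2 * (r - 1)) + (#|U| - r.+1 - #|Nr|) * (2 * #|W :&: C|) + #|W :\: C| * (r - 1).
  rewrite (bigID (mem Nr)) /= -addnA; apply: leq_add.
    apply: (@leq_trans (\sum_(x in Nr) 2 * (r - 1))); last by rewrite sum_nat_const.
    rewrite (eq_bigl (mem Nr)); last first.
      by move=> x; rewrite !inE; case: (x \in C); rewrite ?andbF.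
    apply: leq_sum => x xN; have xC : x \notin C by move: xN; rewrite /Nr /= !inE => /andP[].
    by have := lt x xC; have := dg_split G C x; clear; lia.
  (* A vertex outside [Nr] accounts for its neighbours in [W :&: C] twice and for those in [W :\: C]
     once. The latter are counted from [W :\: C], where degrees are below [r]. *)
  apply: (@leq_trans (\sum_(x in ~: C | x \notin Nr) ((x \in U) * (2 * #|W :&: C|) +
      #|nb G x :&: (W :\: C)|))).
    apply: leq_sum => x /andP[]; rewrite inE => xC xN.
    have sW := restW x xC xN.
    have c1 : #|nb G x :&: C| <= #|W :&: C| by apply/subset_leq_card/setSI.
    have c2 : nb G x :&: (W :\: C) = nb G x :\: C.
      apply/setP => y; rewrite in_setI [y \in W :\: C]in_setD [y \in _ :\: C]in_setD in_nb.
      case: (boolP (G x y)) => g; rewrite ?andbF //.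
      by rewrite (subsetP sW) ?in_nb // !andbT.
    have := dg_split G C x; rewrite c2; case: (boolP (x \in U)) => xU.
      by move: c1; clear; lia.
    have -> : dg G x = 0.
      apply/eqP; rewrite cards_eq0; apply/eqP/setP => y; rewrite !inE.
      by apply: contraNF xU => g; apply: (inU x y).
    by clear; lia.
  rewrite big_split /=; apply: leq_add.
    rewrite -big_distrl /= leq_mul2r; apply/orP; right.
    rewrite -card_UD -(cardsID Nr (U :\: C)) (setIidPr nrU) addKn.
    rewrite -[X in _ <= X]sum1_card [X in _ <= X]big_mkcond /= big_mkcond /=.
    apply: leq_sum => x _; rewrite !inE; case: (x \in C) => //=.
    by case: (x \in U); rewrite ?andbF ?andbT /=; case: ((_ || _) || _).
  apply: (@leq_trans (\sum_(x in ~: C) #|nb G x :&: (W :\: C)|)).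
    by rewrite [X in _ <= X](bigID (mem Nr)) /= leq_addl.
  rewrite sum_nbI // -sum_nat_const; apply: leq_sum => x; rewrite inE => /andP[xC _].
  have := lt x xC; have := dg_split G (~: C) x; clear; lia.
have tot := sum_dg_split C S; have inn := sum_in sG.
have lNr : #|Nr| + r.+1 <= #|U|.
  by have := subset_leq_card nrU; rewrite card_UD; move: U5; clear; lia.
apply: (@tail_arith r #|U| #|W :&: C| #|W :\: C| #|Nr| (\sum_x dg G x)) => //.
  by move: cW dga lW; clear; lia.
by rewrite tot; move: sumO inn; clear; lia.
Qed.

End LowTail.

(** * Complements with at most three edges *)

Section Labels.
Variable V : finType.
Implicit Types (G : rel V) (C : {set V}).

(** Here [s] lists the vertices that may miss others and [ks] their places in K_3 u P_3; all other
    vertices get distinct labels from 7 on. *)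
Lemma good_pattern G C (s : seq V) (ks : seq nat) :
  uniq s -> uniq ks -> size ks = size s -> all (fun k => k < 7) ks ->
  (forall x y, x \in C -> y \in C -> x != y -> ~~ G x y -> exists i j,
    [/\ i < size s, j < size s, nth x s i = x, nth y s j = y &
        K3P3_edge (nth 0 ks i) (nth 0 ks j)]) -> good G C.
Proof.
move=> us uk sz /allP lt7 cover.
pose l x := if x \in s then nth 0 ks (index x s) else 7 + enum_rank x.
have lE x i : i < size s -> nth x s i = x -> l x = nth 0 ks i.
  move=> lti E; rewrite /l -E mem_nth //; congr (nth _ _ _).
  by rewrite index_uniq.
have l7 x : x \in s -> nth 0 ks (index x s) < 7.
  by move=> xs; apply: lt7; rewrite mem_nth // sz index_mem.
exists l; split.
  move=> x y _ _; rewrite /l; case: ifP => xs; case: ifP => ys.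
  - move/eqP; rewrite nth_uniq ?sz ?index_mem // => /eqP E.
    by rewrite -(nth_index x xs) E nth_index.
  - by move=> E; have := l7 x xs; rewrite E; lia.
  - by move=> E; have := l7 y ys; rewrite -E; lia.
  - by move/addnI/val_inj/enum_rank_inj.
move=> x y xC yC nxy ng; have [i [j [li lj ei ej]]] := cover x y xC yC nxy ng.
by rewrite (lE x i) // (lE y j).
Qed.

Lemma same_pairP (a b x y : V) : same_pair a b x y -> (x = a /\ y = b) \/ (x = b /\ y = a).
Proof. by case/orP => /andP[/eqP-> /eqP->]; [left|right]. Qed.

Definition covers G C (l : seq (V * V)) :=
  forall x y, x \in C -> y \in C -> x != y -> ~~ G x y -> has (fun e => same_pair e.1 e.2 x y) l.

Lemma good_cherry G C x y z p q : x != y -> x != z -> y != z -> p != q ->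
  (p == x -> (q == y) || (q == z)) -> (q == x -> (p == y) || (p == z)) ->
  covers G C [:: (x, y); (x, z); (p, q)] -> good G C.
Proof.
move=> nxy nxz nyz npq hp hq cov.
have tri : (forall a b, same_pair p q a b -> a \in C -> b \in C -> a \in [:: x; y; z] /\ b \in [:: x; y; z]) ->
    good G C.
  move=> h; apply: (@good_pattern _ _ [:: x; y; z] [:: 0; 1; 2]) => //.
    by rewrite /= !inE negb_or nxy nxz nyz.
  move=> a b aC bC nab ng; have := cov a b aC bC nab ng; rewrite /= orbF => h3.
  have [ha hb] : a \in [:: x; y; z] /\ b \in [:: x; y; z].
    case/or3P: h3 => [/same_pairP|/same_pairP|/h]; last by apply.
      by case=> [[-> ->]|[-> ->]]; split; rewrite !inE eqxx ?orbT.
    by case=> [[-> ->]|[-> ->]]; split; rewrite !inE eqxx ?orbT.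
  have idx c : c \in [:: x; y; z] -> exists2 i, i < 3 & nth c [:: x; y; z] i = c.
    by rewrite !inE => /or3P[]/eqP->; [exists 0|exists 1|exists 2].
  have [i li ei] := idx a ha; have [j lj ej] := idx b hb.
  have nij : i != j.
    apply: contraNneq nab => E; rewrite -ei -ej E; apply/eqP; exact: set_nth_default.
  exists i, j; split=> //; move: nij li lj; clear.
  by case: i => [|[|[|i]]] //; case: j => [|[|[|j]]].
have path t w v : t != x -> t != y -> t != z -> [set v; w] = [set y; z] -> w != v -> x != w -> x != v ->
    (forall a b, same_pair p q a b -> same_pair t w a b) -> good G C.
  move=> tx ty tz E nwv nxw nxv h.
  have tw : t != w by move/setP/(_ w): E; rewrite !inE eqxx orbT => /esym/orP[]/eqP->.
  have tv : t != v by move/setP/(_ v): E; rewrite !inE eqxx => /esym/orP[]/eqP->.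
  have key a : (a == y) || (a == z) -> (a == v) || (a == w) by move/setP/(_ a): E; rewrite !inE => ->.
  apply: (@good_pattern _ _ [:: t; w; x; v] [:: 3; 4; 5; 6]) => //.
    by rewrite /= !inE !negb_or tw tx tv eq_sym nxw nwv nxv.
  move=> a b aC bC nab ng; have := cov a b aC bC nab ng; rewrite /= orbF.
  have star e : (e == v) || (e == w) -> same_pair x e a b -> exists i j,
     [/\ i < 4, j < 4, nth a [:: t; w; x; v] i = a, nth b [:: t; w; x; v] j = b &
        K3P3_edge (nth 0 [:: 3; 4; 5; 6] i) (nth 0 [:: 3; 4; 5; 6] j)].
    move=> /orP[]/eqP-> /same_pairP[[-> ->]|[-> ->]].
    - by exists 2, 3.
    - by exists 3, 2.
    - by exists 2, 1.
    - by exists 1, 2.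
  case/or3P => [g|g|/h].
  - by apply: (star y) => //; apply: key; rewrite eqxx.
  - by apply: (star z) => //; apply: key; rewrite eqxx orbT.
  by case/same_pairP => [[-> ->]|[-> ->]]; [exists 0, 1|exists 1, 0].
have sep : p \notin [:: x; y; z] -> q \notin [:: x; y; z] -> good G C.
  rewrite !inE !negb_or => /and3P[px py pz] /and3P[qx qy qz].
  apply: (@good_pattern _ _ [:: x; y; z; p; q] [:: 0; 1; 2; 3; 4]) => //.
    by rewrite /= !inE !negb_or nxy nxz nyz npq (eq_sym x p) (eq_sym x q) (eq_sym y p) (eq_sym y q) (eq_sym z p) (eq_sym z q) px py pz qx qy qz.
  move=> a b aC bC nab ng; have := cov a b aC bC nab ng; rewrite /= orbF.
  case/or3P => /same_pairP [[-> ->]|[-> ->]].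
  - by exists 0, 1.
  - by exists 1, 0.
  - by exists 0, 2.
  - by exists 2, 0.
  - by exists 3, 4.
  - by exists 4, 3.
have [px|px] := eqVneq p x.
  have qq : q \in [:: x; y; z] by rewrite !inE hp ?px ?orbT // .
  by apply: tri => a b /same_pairP[[-> ->]|[-> ->]] _ _; split=> //; rewrite px inE eqxx.
have [qx|qx] := eqVneq q x.
  have pp : p \in [:: x; y; z] by rewrite !inE hq ?qx ?orbT // .
  by apply: tri => a b /same_pairP[[-> ->]|[-> ->]] _ _; split=> //; rewrite qx inE eqxx.
have [ip|np] := boolP (p \in [:: x; y; z]); have [iq|nq] := boolP (q \in [:: x; y; z]).
- by apply: tri => a b /same_pairP[[-> ->]|[-> ->]].
- move: ip nq; rewrite !inE (negbTE px) !negb_or /= => /orP[]/eqP pE /and3P[_ qy qz].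
    apply: (path q y z) => //; first by rewrite setUC.
    by move=> a b; rewrite pE /same_pair orbC.
  apply: (path q z y) => //; first by rewrite eq_sym.
  by move=> a b; rewrite pE /same_pair orbC.
- move: iq np; rewrite !inE (negbTE qx) !negb_or /= => /orP[]/eqP qE /and3P[_ qy qz].
    apply: (path p y z) => //; first by rewrite setUC.
    by move=> a b; rewrite qE.
  apply: (path p z y) => //; first by rewrite eq_sym.
  by move=> a b; rewrite qE.
- exact: sep.
Qed.

(** The sum counts ordered pairs, so at most three pairs are missing. If two of them meet,
    [good_cherry] applies, the star being excluded by the degree condition. Otherwise they form a
    matching, placed on 01, 34, 56. *)
Lemma good_three G C : sgraph G ->
  \sum_(x in C) #|[set y in C | (y != x) && ~~ G x y]| <= 6 ->
  (forall x, x \in C -> #|[set y in C | (y != x) && ~~ G x y]| <= 2) -> good G C.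
Proof.
move=> [S I] sum deg2.
pose E : {set V * V} := [set e : V * V | [&& e.1 \in C, e.2 \in C, e.2 != e.1 & ~~ G e.1 e.2]].
have cE : #|E| <= 6.
  apply: leq_trans sum; rewrite -sum1_card.
  rewrite (eq_bigl (fun e : V * V => (e.1 \in C) && [&& e.2 \in C, e.2 != e.1 & ~~ G e.1 e.2])); last first.
    by move=> e; rewrite inE.
  rewrite -(pair_big_dep (mem C) (fun x y => [&& y \in C, y != x & ~~ G x y]) (fun _ _ => 1)) /=.
  by apply: leq_sum => x xC; rewrite sum1dep_card.
have inE' x y : ((x, y) \in E) = [&& x \in C, y \in C, y != x & ~~ G x y] by rewrite inE.
have symE x y : ((x, y) \in E) = ((y, x) \in E).
  by rewrite !inE' S eq_sym; case: (x \in C); case: (y \in C).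
have step (F : {set V * V}) : (forall x y, ((x, y) \in F) = ((y, x) \in F)) -> F \subset E ->
    F = set0 \/ exists a b, [/\ (a, b) \in F, #|F :\ (a, b) :\ (b, a)| + 2 <= #|F| &
      forall x y, ((x, y) \in F :\ (a, b) :\ (b, a)) = ((y, x) \in F :\ (a, b) :\ (b, a))].
  move=> sF FE; have [->|/set0Pn [[a b] ab]] := eqVneq F set0; first by left.
  right; exists a, b; split=> //.
    have := cardsD1 (a, b) F; have := cardsD1 (b, a) (F :\ (a, b)).
    have : (b != a) by have := subsetP FE _ ab; rewrite inE' => /and4P[].
    rewrite !in_setD1 ab (sF b a) ab xpair_eqE => /negbTE-> /=; by move=> e1 e2; rewrite e2 e1 !add1n addn2.
  move=> x y; rewrite !in_setD1 !xpair_eqE (sF x y).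
  by case: (x == a); case: (x == b); case: (y == a); case: (y == b).
have neqE x y : (x, y) \in E -> x != y by rewrite inE' eq_sym => /and4P[].
have cov l : (forall x y, (x, y) \in E -> has (fun e => same_pair e.1 e.2 x y) l) -> covers G C l.
  by move=> h x y xC yC nxy ng; apply: h; rewrite inE' xC yC eq_sym nxy.
have deg x y z t : (x, y) \in E -> (x, z) \in E -> (x, t) \in E -> y != z -> (t == y) || (t == z).
  move=> hy hz ht nyz; apply/negPn/negP; rewrite negb_or => /andP[ty tz].
  have xC : x \in C by move: hy; rewrite inE' => /andP[].
  have := deg2 x xC; rewrite leqNgt => /negP; apply.
  have: [set y; z; t] \subset [set y in C | (y != x) && ~~ G x y].
    by apply/subsetP => w; rewrite !inE => /orP[/orP[]|]/eqP->; [move: hy|move: hz|move: ht]; rewrite inE' => /andP[_].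
  move/subset_leq_card; apply: leq_trans.
  by rewrite setUC cardsU1 cards2 !inE negb_or ty tz nyz.
have cherry x y z p q : (x, y) \in E -> (x, z) \in E -> (p, q) \in E -> y != z ->
    (forall u v, (u, v) \in E -> has (fun e => same_pair e.1 e.2 u v) [:: (x, y); (x, z); (p, q)]) -> good G C.
  move=> hy hz hp nyz h; apply: (@good_cherry _ _ x y z p q) => //; try exact: neqE.
  - by move/eqP=> E'; apply: (deg x) => //; rewrite -E'.
  - by move/eqP=> E'; apply: (deg x) => //; rewrite -E' symE.
  exact: cov.
have share a b c d p q : (a, b) \in E -> (c, d) \in E -> (p, q) \in E -> ~~ same_pair a b c d ->
    [|| a == c, a == d, b == c | b == d] ->
    (forall u v, (u, v) \in E -> has (fun e => same_pair e.1 e.2 u v) [:: (a, b); (c, d); (p, q)]) -> good G C.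
  move=> hab hcd hpq nd sh h.
  have sw (x y u v : V) : same_pair x y u v = same_pair y x u v by rewrite /same_pair orbC.
  case/or4P: sh => /eqP Es; subst.
  - apply: (cherry c b d p q) => //; apply: contraNneq nd => ->.
    by rewrite /same_pair !eqxx.
  - apply: (cherry d b c p q) => //; rewrite 1?symE //.
      by apply: contraNneq nd => ->; rewrite /same_pair !eqxx orbT.
    by move=> u v /h; rewrite /= (sw c d).
  - apply: (cherry c a d p q) => //; rewrite 1?symE //.
      by apply: contraNneq nd => ->; rewrite /same_pair !eqxx orbT.
    by move=> u v /h; rewrite /= (sw a c).
  - apply: (cherry d a c p q) => //; rewrite 1?symE //.
      by apply: contraNneq nd => ->; rewrite /same_pair !eqxx.
    by move=> u v /h; rewrite /= (sw a d) (sw c d).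
have [E0|[a [b [ab c1 s1]]]] := step E symE (subxx _).
  apply: good_clique => x y xC yC nxy; apply/negPn/negP => ng.
  by have := inE' x y; rewrite E0 in_set0 xC yC eq_sym nxy ng.
have in1 x y : (x, y) \in E -> same_pair a b x y \/ (x, y) \in E :\ (a, b) :\ (b, a).
  move=> h; rewrite !in_setD1 h andbT !xpair_eqE /same_pair.
  by case: (x == a); case: (x == b); case: (y == a); case: (y == b); auto.
have sub1 : E :\ (a, b) :\ (b, a) \subset E by apply: subset_trans (subsetDl _ _) (subsetDl _ _).
have np1 x y : (x, y) \in E :\ (a, b) :\ (b, a) -> ~~ same_pair a b x y.
  rewrite !in_setD1 !xpair_eqE /same_pair.
  by case: (x == a); case: (x == b); case: (y == a); case: (y == b).
have [E0|[c [d [cd c2 s2]]]] := step _ s1 sub1.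
  apply: (@good_pattern _ _ [:: a; b] [:: 0; 1]) => //.
    by rewrite /= inE neqE.
  move=> x y xC yC nxy ng.
  have : (x, y) \in E by rewrite inE' xC yC eq_sym nxy.
  by case/in1 => [/same_pairP[[-> ->]|[-> ->]]|]; [exists 0, 1|exists 1, 0|rewrite E0 in_set0].
set E1 := E :\ (a, b) :\ (b, a) in c1 s1 in1 sub1 np1 cd c2 s2.
have in2 x y : (x, y) \in E1 -> same_pair c d x y \/ (x, y) \in E1 :\ (c, d) :\ (d, c).
  move=> h; rewrite 2!in_setD1 h andbT !xpair_eqE /same_pair.
  by case: (x == c); case: (x == d); case: (y == c); case: (y == d); auto.
have sub2 : E1 :\ (c, d) :\ (d, c) \subset E1 by apply: subset_trans (subsetDl _ _) (subsetDl _ _).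
have np2 x y : (x, y) \in E1 :\ (c, d) :\ (d, c) -> ~~ same_pair c d x y.
  rewrite 2!in_setD1 !xpair_eqE /same_pair.
  by case: (x == c); case: (x == d); case: (y == c); case: (y == d).
have cdE := subsetP sub1 _ cd.
have sub3 : E1 :\ (c, d) :\ (d, c) \subset E by apply: subset_trans sub2 sub1.
have [E0|[e [f [ef c3 s3]]]] := step _ s2 sub3.
  have two u v : (u, v) \in E -> has (fun e => same_pair e.1 e.2 u v) [:: (a, b); (c, d); (a, b)].
    by move=> h /=; case/in1: h => [->//|/in2[->|]]; rewrite ?orbT // E0 in_set0.
  have [sh|nsh] := boolP [|| a == c, a == d, b == c | b == d].
    by apply: (share a b c d a b) => //; apply: np1.
  move: nsh; rewrite !negb_or => /and4P[nac nad nbc nbd].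
  apply: (@good_pattern _ _ [:: a; b; c; d] [:: 0; 1; 3; 4]) => //.
    by rewrite /= !inE !negb_or nac nad nbc nbd !neqE.
  move=> x y xC yC nxy ng; have : (x, y) \in E by rewrite inE' xC yC eq_sym nxy.
  move/two; rewrite /= orbF => /or3P[]/same_pairP[[-> ->]|[-> ->]].
  - by exists 0, 1.
  - by exists 1, 0.
  - by exists 2, 3.
  - by exists 3, 2.
  - by exists 0, 1.
  - by exists 1, 0.
have efE := subsetP sub3 _ ef.
have E3 : E1 :\ (c, d) :\ (d, c) :\ (e, f) :\ (f, e) = set0.
  by apply/eqP; rewrite -cards_eq0; move: c1 c2 c3 cE; clear; lia.
have in3 x y : (x, y) \in E -> [|| same_pair a b x y, same_pair c d x y | same_pair e f x y].
  case/in1 => [->//|/in2[->|h]]; first by rewrite orbT.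
  have : (x, y) \notin E1 :\ (c, d) :\ (d, c) :\ (e, f) :\ (f, e) by rewrite E3 in_set0.
  rewrite 2!in_setD1 h andbT !xpair_eqE /same_pair.
  by case: (x == e); case: (x == f); case: (y == e); case: (y == f); rewrite ?orbT.
have [sh|nsh] := boolP [|| a == c, a == d, b == c | b == d].
  by apply: (share a b c d e f) => //; [apply: np1|move=> u v /in3; rewrite /= orbF].
have [sh|nsh2] := boolP [|| a == e, a == f, b == e | b == f].
  apply: (share a b e f c d) => //; first by apply: np1; apply: (subsetP sub2).
  by move=> u v /in3; rewrite /= orbF => /or3P[] ->; rewrite ?orbT.
have [sh|nsh3] := boolP [|| c == e, c == f, d == e | d == f].
  apply: (share c d e f a b) => //; first by apply: np2.
  by move=> u v /in3; rewrite /= orbF => /or3P[] ->; rewrite ?orbT.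
move: nsh nsh2 nsh3; rewrite !negb_or => /and4P[? ? ? ?] /and4P[? ? ? ?] /and4P[h1 h2 h3 h4].
apply: (@good_pattern _ _ [:: a; b; c; d; e; f] [:: 0; 1; 3; 4; 5; 6]) => //.
  have nab := neqE _ _ ab; have ncd := neqE _ _ cdE; have nef := neqE _ _ efE.
  rewrite /= !inE !negb_or nab ncd nef h1 h2 h3 h4 /=.
  by do ! [apply/andP; split=> //].
move=> x y xC yC nxy ng; have : (x, y) \in E by rewrite inE' xC yC eq_sym nxy.
move/in3 => /or3P[]/same_pairP[[-> ->]|[-> ->]].
- by exists 0, 1.
- by exists 1, 0.
- by exists 2, 3.
- by exists 3, 2.
- by exists 4, 5.
- by exists 5, 4.
Qed.

End Labels.

(** The 6 is the surplus of a complete core with outer vertices at the rate [2 r - 5]; [p] is what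
    the outer vertices add beyond that rate. *)
Lemma deficit_arith r n m s t p : 3 <= r -> r.+1 <= n ->
  s + m = r.+1 * r -> t <= (n - r.+1) * (2 * r - 5) + p ->
  2 * r * n + 4 * r <= s + t + r * r + 1 + 5 * n -> m <= 6 + p.
Proof.
move=> r3 rn; have [e E] : exists e, r = e + 3 by exists (r - 3); lia.
have [k ->] : exists k, n = k + r.+1 by exists (n - r.+1); lia.
rewrite {}E {r3 rn}.
rewrite addnK (_ : 2 * (e + 3) - 5 = 2 * e + 1); last by lia.
by lia.
Qed.

Lemma card_sum (V : finType) (A : {set V}) : #|A| = \sum_x (x \in A : nat).
Proof. by rewrite -sum1_card big_mkcond; apply: eq_bigr => x _; case: (x \in A). Qed.

(** * Nonadjacent pairs inside the core *)

Section Deficit.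
Variable V : finType.
Variables (U C : {set V}) (r : nat).
Hypotheses (CU : C \subset U) (cC : #|C| = r.+1) (r3 : 3 <= r) (U5 : 5 * r + 18 <= #|U|).
Variable G : rel V.
Hypothesis tail : low_tail U C r G.

Definition inner_edges (H : rel V) : {set V * V} := [set e : V * V | [&& e.1 \in C, e.2 \in C & H e.1 e.2]].
Hypothesis Gmax : forall G', sgraph G' -> dg G' =1 dg G -> #|inner_edges G'| <= #|inner_edges G|.

Definition missing x := [set y in C | (y != x) && ~~ G x y].
Definition outer x := nb G x :\: C.

Let sG : sgraph G. Proof. by case: tail. Qed.
Let S : symmetric G. Proof. by case: sG. Qed.
Let I : irreflexive G. Proof. by case: sG. Qed.

Lemma missingC x y : x \in C -> y \in missing x -> x \in missing y.
Proof. by move=> xC; rewrite !inE xC => /and3P[_ n g]; rewrite eq_sym n S. Qed.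

Lemma missing_in x y : y \in missing x -> y \in C. Proof. by rewrite inE => /andP[]. Qed.

Lemma missing_nb x : x \in C -> #|nb G x :&: C| + #|missing x| = r.
Proof.
move=> xC; have := cardsD1 x C; rewrite xC cC add1n => -[->].
rewrite -(cardsID (nb G x) (C :\ x)); congr (_ + _); apply: eq_card => y; rewrite !inE.
  by case: (eqVneq y x) => [->|]; rewrite ?I // andbC.
by case: (y \in C); case: (y == x); case: (G x y).
Qed.

Lemma missing_dg x : x \in C -> dg G x + #|missing x| = r + #|outer x|.
Proof. by move=> xC; have := missing_nb xC; rewrite (dg_split G C x) /outer; clear; lia. Qed.

Lemma closed_or x y : x \in C -> y \in missing x -> outer x != set0 -> outer y = set0.
Proof.
move=> xC yx ox; apply/eqP/negPn/negP => oy.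
have yC := missing_in yx; move: (yx); rewrite !inE => /and3P[_ nyx ngxy].
have [|G' [s' d' c' g']] := open_addable CU cC U5 tail xC yC _ ox oy; first by rewrite eq_sym.
have := Gmax s' d'; rewrite leqNgt => /negP; apply; apply: proper_card; apply/properP; split.
  by apply/subsetP => -[p q]; rewrite !inE /= => /and3P[pC qC g]; rewrite pC qC c'.
by exists (x, y); rewrite inE /= xC yC ?g' // (negbTE ngxy).
Qed.

(** Trade [xa], [q'q] for [xq], [q'a] with [a] an outer neighbour of [x]. Now [q'] has an outer
    neighbour, and the final disjunction ensures that [x'] still has one, so [open_addable] adds
    [x'q']. Inside [C] one edge is lost and two are gained, against maximality. *)
Lemma no_crossing q q' x x' : q \in C -> q' \in C -> outer q = set0 -> outer q' = set0 ->
  G q q' -> x \in missing q -> x' \in missing q' -> outer x != set0 -> outer x' != set0 ->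
  x != x' \/ 1 < #|outer x| -> False.
Proof.
move=> qC q'C oq oq' gqq xq xq' ox ox' hx.
have xC := missing_in xq; have x'C := missing_in xq'.
move: (xq) (xq'); rewrite !inE => /and3P[_ nxq ngqx] /and3P[_ nxq' ngqx'].
have [a aO] := set0Pn _ ox; move: (aO); rewrite !inE => /andP[aC gxa].
have nq'a : q' != a by apply: contraNneq aC => <-.
have ngq'a : ~~ G q' a.
  by apply/negP => g; move/setP/(_ a): oq'; rewrite !inE aC g.
have ngxq : ~~ G x q by rewrite S.
have gq'q : G q' q by rewrite S.
have [s1 d1] := switch_spec sG gxa gq'q nxq nq'a ngxq ngq'a.
set G1 := switch G x a q' q in s1 d1.
have nqq' := adj_neq sG gqq.
have nxq2 : x != q' by apply: contraNneq ox => ->; rewrite oq'.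
have nx'q : x' != q by apply: contraNneq ox' => ->; rewrite oq.
have nxa : x != a by apply: contraNneq aC => <-.
have nx'a : x' != a by apply: contraNneq aC => <-.
have o1 : nb G1 x' :\: C != set0.
  have [a' a'C h] : exists2 a', a' \notin C & G x' a' && ((x' != x) || (a' != a)).
    have [E|ne] := eqVneq x' x.
      have : 1 < #|outer x| by case: hx => //; rewrite E eqxx.
      rewrite (cardsD1 a) aO add1n ltnS => /card_gt0P [a']; rewrite !inE => /and3P[n1 n2 n3].
      by exists a' => //; rewrite E n3 n1 orbT.
    by have [a'] := set0Pn _ ox'; rewrite !inE => /andP[n1 n2]; exists a'; rewrite ?n2.
  case/andP: h => g h.
  apply/set0Pn; exists a'; rewrite !inE a'C /= /G1 /switch g /= /same_pair.
  apply/orP; right; rewrite (negbTE nx'a) (negbTE nxq') (negbTE nx'q) /= !orbF andbT.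
  by rewrite negb_and.
have o2 : nb G1 q' :\: C != set0.
  by apply/set0Pn; exists a; rewrite !inE aC /= /G1 /switch /same_pair !eqxx orbT.
have tail1 := low_tail_same s1 d1 tail.
have [G2 [s2 d2 c2 g2]] := open_addable CU cC U5 tail1 x'C q'C nxq' o1 o2.
have d12 : dg G2 =1 dg G by move=> y; rewrite d2 d1.
have := Gmax s2 d12; rewrite leqNgt => /negP; apply.
have gxq2 : G2 x q by apply: c2 => //; rewrite /G1 /switch /same_pair !eqxx.
have keep y z : y \in C -> z \in C -> G y z -> ~~ same_pair q' q y z -> G2 y z.
  move=> yC zC g np; apply: c2 => //; rewrite /G1 /switch g np /= andbT; apply/orP; right.
  apply/negP => /same_pairP[[_ E]|[E _]]; by move: aC; rewrite -E ?yC ?zC.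
have sub : (x, q) |: ((q, x) |: ((x', q') |: (inner_edges G :\ (q, q') :\ (q', q))))
    \subset inner_edges G2.
  apply/subsetP => -[y z]; rewrite !in_setU1 !in_setD1 !xpair_eqE [(y, z) \in _]inE /=.
  case/orP => [/andP[/eqP-> /eqP->]|].
    by rewrite inE /= xC qC.
  case/orP => [/andP[/eqP-> /eqP->]|].
    by rewrite inE /= xC qC s2.1.
  case/orP => [/andP[/eqP-> /eqP->]|].
    by rewrite inE /= x'C q'C.
  case/and3P => n1 n2 /and3P[yC zC g]; rewrite inE /= yC zC keep //.
  by rewrite /same_pair negb_or n1 n2.
apply: leq_trans (subset_leq_card sub).
have := cardsD1 (q, q') (inner_edges G); have := cardsD1 (q', q) (inner_edges G :\ (q, q')).
rewrite !cardsU1 !in_setU1 !in_setD1 !xpair_eqE !inE /= !(qC, q'C, xC, x'C) gqq gq'q.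
rewrite (eq_sym q x) (negbTE nxq) (negbTE nxq2) (eq_sym q' q) (negbTE nqq') (eq_sym q x') (negbTE nx'q) ?(eq_sym q' x).
rewrite (S q x) (negbTE ngxq) (S x' q') (negbTE ngqx') /= ?andbF ?orbF ?(negbTE nxq2) ?(negbTE nqq') /=.
by move=> e1 e2; rewrite e2 e1 !add1n.
Qed.

Definition deficient := [set q in C | (outer q == set0) && (missing q != set0)].

Lemma deficient_in q : q \in deficient -> [/\ q \in C, outer q = set0 & missing q != set0].
Proof. by rewrite inE => /and3P[? /eqP ? ?]. Qed.

Lemma deficient_dg q : q \in deficient -> dg G q + #|missing q| = r.
Proof. by move=> /deficient_in [qC oq _]; have := missing_dg qC; rewrite oq cards0 addn0. Qed.

Lemma not_deficient_open q x : q \in C -> x \in missing q -> x \notin deficient -> outer x != set0.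
Proof.
move=> qC xq; apply: contra => /eqP ox; rewrite inE (missing_in xq) ox eqxx /=.
by apply/set0Pn; exists q; apply: missingC.
Qed.

(** By [closed_or] every nonadjacent pair in [C] meets [deficient]. A pair with just one end there
    is charged twice to that end. *)
Lemma sum_missing : \sum_(x in C) #|missing x| = \sum_(q in deficient) (#|missing q| + #|missing q :\: deficient|).
Proof.
pose R : rel V := fun x y => [&& x \in C, y \in C, y != x & ~~ G x y].
have sR : symmetric R.
  by move=> x y; rewrite /R S eq_sym; case: (x \in C); case: (y \in C).
have nbR x : x \in C -> nb R x = missing x by move=> xC; apply/setP => y; rewrite !inE /R xC.
have KC : deficient \subset C by apply/subsetP => q /deficient_in[].
rewrite (big_setID deficient) /= (setIidPr KC) big_split /=; congr (_ + _).
transitivity (\sum_(x in C :\: deficient) #|nb R x :&: deficient|).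
  apply: eq_bigr => x; rewrite inE => /andP[xK xC]; rewrite nbR //; congr #|pred_of_set _|.
  apply/esym/setIidPl/subsetP => y yx; have yC := missing_in yx.
  rewrite inE yC; have ox : outer x != set0 by apply: (not_deficient_open yC) => //; apply: missingC.
  rewrite (closed_or xC yx ox) eqxx /=.
  by apply/set0Pn; exists x; apply: missingC.
rewrite sum_nbI //; apply: eq_bigr => q /deficient_in[qC _ _]; rewrite nbR //.
congr #|pred_of_set _|; apply/setP => y; rewrite !inE.
by case: (y \in C); rewrite ?andbF // ?andbT andbC.
Qed.

(** A deficient vertex misses exactly one vertex, so the sum is at most [#|deficient| + #|Kt|] with
    [#|deficient| <= 5]. If [Kt] has two elements, [no_crossing] forces all of [Kt] to miss one
    vertex [x1] with a single outer neighbour. Then [x1] has degree [r - 1] and [#|Kt| = 2], and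
    [x1] takes one of the five places, so the sum is at most [4 + 2]. *)
Lemma sum_missing_flat : (forall c, c \in C -> r <= dg G c + 1) ->
  #|[set c in C | dg G c < r]| <= 5 -> \sum_(x in C) #|missing x| <= 6.
Proof.
move=> deg1 N5; rewrite sum_missing.
have mis1 q : q \in deficient -> #|missing q| = 1.
  move=> qK; have [qC _ m0] := deficient_in qK; have := deficient_dg qK; have := deg1 q qC.
  by move: m0; rewrite -card_gt0; clear; lia.
pose Kt := [set q in deficient | missing q :\: deficient != set0].
have le : \sum_(q in deficient) (#|missing q| + #|missing q :\: deficient|) <= #|deficient| + #|Kt|.
  rewrite big_split /=; apply: leq_add.
    by rewrite -sum1_card; apply: leq_sum => q /mis1->.
  apply: (@leq_trans (\sum_(q in deficient) (q \in Kt))).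
    apply: leq_sum => q qK; rewrite [q \in Kt]inE qK /=.
    have := subset_leq_card (subsetDl (missing q) deficient); rewrite mis1 //.
    by case: (eqVneq (missing q :\: deficient) set0) => [->|_]; rewrite ?cards0.
  by rewrite card_sum big_mkcond /=; apply: leq_sum => q _; case: (q \in deficient).
have KN : deficient \subset [set c in C | dg G c < r].
  apply/subsetP => q qK; have [qC _ _] := deficient_in qK; have := deficient_dg qK; rewrite mis1 // => e.
  by rewrite inE qC /= -e addn1.
have cK := leq_trans (subset_leq_card KN) N5.
have [t1|] := leqP #|Kt| 1; first by move: le cK t1; clear; lia.
move/card_gt1P => [q1 [q2 [q1t q2t n12]]].
have inKt q : q \in Kt -> q \in deficient /\ exists x, [/\ x \in missing q, x \notin deficient & outer x != set0].
  rewrite inE => /andP[qK /set0Pn [x]]; rewrite inE => /andP[xK xq]; split=> //.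
  by have [qC _ _] := deficient_in qK; exists x; split=> //; apply: (not_deficient_open qC).
have [q1K [x1 [x1q x1K x1o]]] := inKt _ q1t.
have [q1C o1 _] := deficient_in q1K.
have adj q : q \in deficient -> q != q1 -> G q1 q.
  move=> qK nq; apply/negPn/negP => ng; have [qC _ _] := deficient_in qK.
  have /eqP/cards1P [z E] := mis1 _ q1K.
  have : q \in missing q1 by rewrite inE qC nq ng.
  move: x1q; rewrite E !inE => /eqP E1 /eqP E2; move: x1K; by rewrite E1 -E2 qK.
have sub : Kt \subset missing x1.
  apply/subsetP => q qt; have [qK [x [xq xK xo]]] := inKt _ qt.
  have [qC oq _] := deficient_in qK.
  have [->|nq] := eqVneq q q1; first exact: missingC.
  have [E|ne] := eqVneq x1 x; first by rewrite E; apply: missingC.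
  by case: (no_crossing q1C qC o1 oq (adj _ qK nq) x1q xq x1o xo (or_introl ne)).
have out1 : #|outer x1| <= 1.
  rewrite leqNgt; apply/negP => gt.
  have [q2K _] := inKt _ q2t; have [q2C o2 _] := deficient_in q2K.
  have x1q2 : x1 \in missing q2 by apply: missingC (missing_in x1q) _; apply: (subsetP sub).
  by apply: (no_crossing q1C q2C o1 o2 _ x1q x1q2 x1o x1o (or_intror gt)); rewrite adj // eq_sym.
have x1C := missing_in x1q.
have := subset_leq_card sub; have := missing_dg x1C; have := deg1 _ x1C => h1 h2 h3.
have [x1N|] := boolP (x1 \in [set c in C | dg G c < r]).
  have : #|x1 |: deficient| <= #|[set c in C | dg G c < r]|.
    by apply/subset_leq_card; rewrite subUset sub1set x1N KN.
  rewrite cardsU1 x1K; move: h1 h2 h3 out1 le N5; clear; lia.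
rewrite inE x1C /= => h4; move: h1 h2 h3 h4 out1 le cK; clear; lia.
Qed.

(** When outer degrees are at most [r - 2], only these outer vertices exceed the rate [2 r - 5],
    each by one. *)
Definition tight := [set o in U :\: C | (dg G o + 2 == r) && (nb G o \subset C)].

Lemma tight_card : (forall o, o \notin C -> dg G o + 2 <= r) ->
  \sum_(x in C) #|missing x| <= 6 + #|tight|.
Proof.
move=> outdeg; have [_ inU _ sum] := tail.
apply: (@deficit_arith r #|U| _ (\sum_(x in C) #|nb G x :&: C|)
   (\sum_(x in ~: C) (#|nb G x :&: C| + dg G x))) => //.
- by rewrite -cC subset_leq_card.
- by rewrite -big_split /= (eq_bigr _ (fun x xC => missing_nb xC)) sum_nat_const cC.
- apply: (@leq_trans (\sum_(x in U :\: C) (2 * r - 5 + (x \in tight)))).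
    rewrite big_mkcond [X in _ <= X]big_mkcond /=; apply: leq_sum => x _.
    rewrite !inE; case: (boolP (x \in C)) => //= xC; case: (boolP (x \in U)) => xU /=.
      have := outdeg x xC; have e := dg_split G C x.
      have [sub|nsub] := boolP (nb G x \subset C); first by move: e; clear; lia.
      have : 0 < #|nb G x :\: C|.
        by have [y g yC] := subsetPn nsub; apply/card_gt0P; exists y; rewrite inE yC.
      by move: e; clear; lia.
    have nb0 : nb G x = set0.
      by apply/setP => y; rewrite !inE; apply: contraNF xU => g; apply: (inU x y).
    by rewrite /dg nb0 set0I cards0.
  rewrite big_split /= sum_nat_const (card_UD CU cC); apply: leq_add => //.
  by rewrite card_sum big_mkcond /=; apply: leq_sum => q _; case: (q \in U :\: C).
by rewrite -(sum_dg_split C S).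
Qed.

(** A sum above 6 needs a tight vertex, which misses just three vertices of [C]. Deficient vertices
    have no outer neighbour, so they are among these three, and each misses at most two vertices;
    the few configurations left are settled by [no_crossing]. *)
Lemma sum_missing_tight : (forall c, c \in C -> r <= dg G c + 2) ->
  (forall o, o \notin C -> dg G o + 2 <= r) -> \sum_(x in C) #|missing x| <= 6.
Proof.
move=> deg2 outdeg; rewrite leqNgt; apply/negP => gt6.
have tc := tight_card outdeg.
have tightE o : o \in tight -> deficient \subset C :\: nb G o /\ #|C :\: nb G o| = 3.
  rewrite !inE => /andP[/andP[oC oU] /andP[/eqP dgo sub]]; split.
    apply/subsetP => q /deficient_in[qC oq _]; rewrite !inE qC andbT.
    by apply/negP => g; move/setP/(_ o): oq; rewrite !inE oC S g.
  by rewrite cardsD (setIidPr sub) cC -dgo /dg; clear; lia.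
have /card_gt0P [o ot] : 0 < #|tight| by move: tc gt6; clear; lia.
have [Ko co] := tightE o ot; have K3 := subset_leq_card Ko; rewrite co in K3.
have mis2 q : q \in deficient -> #|missing q| <= 2.
  by move=> qK; have [qC _ _] := deficient_in qK; have := deficient_dg qK; have := deg2 q qC; clear; lia.
have split q : #|missing q| = #|missing q :&: deficient| + #|missing q :\: deficient| by rewrite cardsID.
have adj q q' : q \in deficient -> q' \in deficient -> q != q' -> q' \notin missing q -> G q q'.
  by move=> _ /deficient_in[q'C _ _] nq; rewrite !inE q'C eq_sym nq /= negbK.
have cross q q' x x' : q \in deficient -> q' \in deficient -> q != q' -> q' \notin missing q ->
    x \in missing q :\: deficient -> x' \in missing q' :\: deficient -> x != x' \/ 1 < #|outer x| -> False.
  move=> qK q'deficient nqq nm; rewrite !inE => /andP[xK xq] /andP[x'deficient xq'].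
  have [qC oq _] := deficient_in qK; have [q'C oq' _] := deficient_in q'deficient.
  have {}xq : x \in missing q by rewrite inE; case/and3P: xq => -> -> ->.
  have {}xq' : x' \in missing q' by rewrite inE; case/and3P: xq' => -> -> ->.
  by apply: (no_crossing qC q'C oq oq' (adj _ _ qK q'deficient nqq nm) xq xq');
    [apply: (not_deficient_open qC)|apply: (not_deficient_open q'C)] => //; rewrite inE.
have mI q q' : q \in deficient -> q' \in deficient -> (q' \in missing q) = (q \in missing q').
  by move=> /deficient_in[qC _ _] /deficient_in[q'C _ _]; apply/idP/idP; apply: missingC.
have sumE := sum_missing; rewrite sumE in gt6 tc.
have [K1|K1] := leqP #|deficient| 1.
  have : \sum_(q in deficient) (#|missing q| + #|missing q :\: deficient|) <= #|deficient| * 4.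
    rewrite -sum_nat_const; apply: leq_sum => q qK.
    by have := mis2 q qK; rewrite split; clear; lia.
  by move: gt6 K1; clear; lia.
have [a aK] : exists a, a \in deficient by apply/card_gt0P; lia.
have ca := cardsD1 a deficient; rewrite aK /= in ca.
have self q : q \notin missing q by rewrite !inE eqxx andbF.
have [K2|K2] := leqP #|deficient| 2.
  have /eqP/cards1P [b Eb] : #|deficient :\ a| = 1 by move: ca K1 K2; clear; lia.
  have : b \in deficient :\ a by rewrite Eb inE.
  rewrite in_setD1 => /andP[nba bK].
  have inK q : q \in deficient -> q = a \/ q = b.
    move=> qK; have [->|nq] := eqVneq q a; first by left.
    by right; apply/eqP; rewrite -in_set1 -Eb in_setD1 nq.
  have mab q q' : q \in deficient -> q' \in deficient -> q' != q -> #|missing q :&: deficient| = (q' \in missing q).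
    move=> qK q'deficient nq; rewrite -sum1_card big_mkcond (bigD1 q') //= big1 ?addn0.
      by rewrite in_setI q'deficient andbT; case: (q' \in missing q).
    move=> p np; case: ifP => //; rewrite in_setI => /andP[pm pK].
    have : p = q.
      by case: (inK _ pK) (inK _ qK) (inK _ q'deficient) np nq => -> [] -> [] ->; rewrite ?eqxx.
    by move=> E; rewrite E (negbTE (self q)) in pm.
  move: gt6; rewrite (big_setD1 a) //= Eb big_set1.
  have ha := mis2 a aK; have hb := mis2 b bK.
  rewrite !(split _) in ha hb *; move: ha hb.
  rewrite (mab a b) // (mab b a) 1?eq_sym // (mI b a) //.
  case: (boolP (b \in missing a)) => [_|nm]; first by clear; lia.
  move=> ha hb h.
  have /card_gt0P [x xa] : 0 < #|missing a :\: deficient| by move: ha hb h; clear; lia.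
  have : 1 < #|missing b :\: deficient| by move: ha hb h; clear; lia.
  rewrite (cardsD1 x) => h2.
  have /card_gt0P [x'] : 0 < #|(missing b :\: deficient) :\ x| by move: h2; clear; case: (_ \in _); lia.
  rewrite in_setD1 => /andP[nx x'b].
  by apply: (cross a b x x') => //; rewrite eq_sym; auto.
have c2 : #|deficient :\ a| = 2 by move: ca K2 K3; clear; lia.
have /eqP/cards2P [b [c [nbc Ebc]]] := c2.
have : b \in deficient :\ a by rewrite Ebc !inE eqxx.
rewrite in_setD1 => /andP[nba bK].
have : c \in deficient :\ a by rewrite Ebc !inE eqxx orbT.
rewrite in_setD1 => /andP[nca cK].
have EK : deficient = [set a; b; c].
  apply/setP => q; have [->|nq] := eqVneq q a; first by rewrite aK !inE eqxx.
  by have := in_setD1 q deficient a; rewrite nq /= => <-; rewrite Ebc !inE (negbTE nq).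
have mK q : #|missing q :&: deficient| = (a \in missing q) + (b \in missing q) + (c \in missing q).
  rewrite -sum1_card big_mkcond (bigD1 a) // (bigD1 b) 1?nba // (bigD1 c) ?nca 1?eq_sym ?nbc //=.
  rewrite big1 ?addn0 => [|p]; last first.
    rewrite -andbA => /and3P[pa pb pc]; case: ifP => //; rewrite in_setI EK !inE.
    by rewrite (negbTE pa) (negbTE pb) (negbTE pc) andbF.
  rewrite !in_setI aK bK cK !andbT addnA.
  by case: (a \in missing q); case: (b \in missing q); case: (c \in missing q).
have ha := mis2 a aK; have hb := mis2 b bK; have hc := mis2 c cK.
have tot : \sum_(q in deficient) (#|missing q| + #|missing q :\: deficient|) =
   (#|missing a| + #|missing a :\: deficient|) + ((#|missing b| + #|missing b :\: deficient|) + (#|missing c| + #|missing c :\: deficient|)).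
  by rewrite (big_setD1 a) //= Ebc big_setU1 ?inE //= big_set1.
rewrite tot in gt6 tc; move: ha hb hc gt6 tc.
rewrite !(split _) !mK (negbTE (self a)) (negbTE (self b)) (negbTE (self c)).
rewrite (mI b a) // (mI c a) // (mI c b) //.
move=> ha hb hc gt6 tc.
(* The sum is even, so above 6 it is at least 8, which takes two tight vertices. *)
have tight2 : 1 < #|tight|.
  move: gt6 tc; clear; case: (b \in missing a); case: (c \in missing a); case: (c \in missing b); lia.
(* Three deficient vertices are exactly the non-neighbours in [C] of every tight vertex. All other
   vertices of [C] then see all tight ones, so [no_crossing] applies even when [x = x']. *)
have out2 x : x \in C -> x \notin deficient -> 1 < #|outer x|.
  move=> xC xK; apply: leq_trans tight2 _; apply/subset_leq_card/subsetP => t tt.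
  have [Kt ct] := tightE t tt.
  have EKt : deficient = C :\: nb G t.
    by apply/eqP; rewrite eqEcard Kt ct; move: K2; clear; lia.
  move: xK; rewrite EKt !inE xC andbT negbK S => ->.
  by move: tt; rewrite !inE => /andP[/andP[-> _] _].
have pos q q' : q \in deficient -> q' \in deficient -> q != q' -> 0 < #|missing q :\: deficient| -> 0 < #|missing q' :\: deficient| ->
    q' \in missing q.
  move=> qK q'deficient nq /card_gt0P [x xq] /card_gt0P [x' xq']; apply/negPn/negP => nm.
  apply: (cross q q' x x') => //; right; apply: out2.
    by move: xq; rewrite !inE => /andP[_ /andP[]].
  by move: xq; rewrite in_setD => /andP[].
have p1 := pos a b aK bK; have p2 := pos a c aK cK; have p3 := pos b c bK cK nbc.
rewrite eq_sym in p1; rewrite eq_sym in p2; have {}p1 := p1 nba; have {}p2 := p2 nca.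
move: ha hb hc gt6 p1 p2 p3; clear.
case: (b \in missing a); case: (c \in missing a); case: (c \in missing b);
  case: #|missing a :\: deficient| => [|oa]; case: #|missing b :\: deficient| => [|ob]; case: #|missing c :\: deficient| => [|oc];
  move=> h1 h2 h3 h4 h5 h6 h7; try lia;
  by [have := h5 isT isT|have := h6 isT isT|have := h7 isT isT].
Qed.

(** A vertex [y] that misses three others is the centre of all missing pairs; it has an outer
    neighbour [a], since a closed vertex misses at most two. Trading [ya], [q2 q1] for [y q1],
    [q2 a] turns the missing star into the path [q1 q2 y q3]. *)
Lemma deficit_good : (forall c, c \in C -> r <= dg G c + 2) ->
  \sum_(x in C) #|missing x| <= 6 -> exists G', [/\ sgraph G', dg G' =1 dg G & good G' C].
Proof.
move=> deg2 sum6.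
have [big|small] := classic (exists2 y, y \in C & 2 < #|missing y|); last first.
  exists G; split=> //; apply: good_three => // x xC; rewrite leqNgt; apply/negP => gt.
  by apply: small; exists x.
have [y yC gt] := big.
have oy : outer y != set0.
  apply: contraTneq gt => E; rewrite -leqNgt; have := missing_dg yC; rewrite E cards0.
  by have := deg2 y yC; clear; lia.
have sumD : \sum_(x in C :\ y) #|missing x| = #|missing y| + \sum_(x in C :\ y) #|missing x :\ y|.
  rewrite (eq_bigr _ (fun x _ => cardsD1 y (missing x))) big_split /=; congr (_ + _).
  rewrite (card_sum (missing y)) big_mkcond /=; apply: eq_bigr => x _.
  rewrite !inE yC (S x) (eq_sym y x); case: (x \in C); rewrite ?andbF ?andbT //=.
  by case: (x != y).
move: sum6; rewrite (big_setD1 y) //= sumD => sum6.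
have only x : x \in C -> x != y -> missing x :\ y = set0.
  move=> xC nxy; apply/eqP; rewrite -cards_eq0 -leqn0.
  have : #|missing x :\ y| <= \sum_(x in C :\ y) #|missing x :\ y|.
    by rewrite (big_setD1 x) ?inE ?nxy //= leq_addr.
  by move: sum6 gt; clear; lia.
have c3 : #|missing y| = 3 by move: sum6 gt; clear; lia.
have [q1 q1y] : exists q, q \in missing y by apply/card_gt0P; rewrite c3.
have := cardsD1 q1 (missing y); rewrite q1y c3 => -[] /esym/eqP/cards2P [q2 [q3 [n23 E23]]].
have q2y : q2 \in missing y :\ q1 by rewrite E23 !inE eqxx.
have q3y : q3 \in missing y :\ q1 by rewrite E23 !inE eqxx orbT.
move: q2y q3y; rewrite !in_setD1 => /andP[n21 q2y] /andP[n31 q3y].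
have misE q : q \in missing y -> [|| q == q1, q == q2 | q == q3].
  move=> h; have [//|nq] := eqVneq q q1.
  by have := in_setD1 q (missing y) q1; rewrite E23 h nq !inE.
have inM q : q \in missing y -> [/\ q \in C, q != y & ~~ G y q] by rewrite inE => /and3P[].
have [q1C n1y ng1] := inM _ q1y; have [q2C n2y ng2] := inM _ q2y; have [q3C n3y ng3] := inM _ q3y.
have [a] := set0Pn _ oy; rewrite !inE => /andP[aC gya].
have g21 : G q2 q1.
  apply/negPn/negP => ng; have /setP/(_ q1) := only _ q2C n2y.
  by rewrite !inE n1y q1C (eq_sym q1) n21 ng.
have o2 := closed_or yC q2y oy.
have ng2a : ~~ G q2 a by apply/negP => g; move/setP/(_ a): o2; rewrite !inE aC g.
have n2a : q2 != a by apply: contraNneq aC => <-.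
have ny1 : y != q1 by rewrite eq_sym.
have [s1 d1] := switch_spec sG gya g21 ny1 n2a ng1 ng2a.
exists (switch G y a q2 q1); split=> //.
apply: (@good_cherry _ _ _ q2 q1 y y q3) => //; try by rewrite // eq_sym.
- by rewrite eq_sym (negbTE n2y).
- by rewrite eq_sym (negbTE n23).
move=> u v uC vC nuv ng /=; rewrite orbF.
have [g|ngg] := boolP (G u v).
  have [//|n1] := boolP (same_pair q2 q1 u v).
  have n2 : ~~ same_pair y a u v.
    by apply/negP => /same_pairP [[_ E]|[E _]]; move: aC; rewrite -E ?uC ?vC.
  by move: ng; rewrite /switch g n1 n2 orbT.
have star q : q \in missing y -> same_pair y q u v -> [|| same_pair q2 q1 u v, same_pair q2 y u v | same_pair y q3 u v].
  move=> /misE/or3P[]/eqP-> h.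
  - by move: ng; rewrite /switch h.
  - by apply/or3P; apply: Or32; move: h; rewrite /same_pair orbC.
  - by rewrite h !orbT.
have [uy|nuy] := eqVneq u y.
  by apply: (star v); rewrite ?inE ?vC -?uy 1?eq_sym ?nuv // /same_pair !eqxx.
have [vy|nvy] := eqVneq v y.
  by apply: (star u); rewrite ?inE ?uC -?vy ?nuv 1?S // /same_pair !eqxx orbT.
by have /setP/(_ v) := only _ uC nuy; rewrite !inE nvy vC eq_sym nuv ngg.
Qed.

End Deficit.

(** * The upper bound *)

(** The case of [r] arbitrary vertices and degrees at most [r - 3] elsewhere: the others account for
    [2 r - 6] each. *)
Lemma sparse_arith r n s : r.+2 <= n -> 3 <= r ->
  s <= r * (r - 1) + (n - r) * (2 * (r - 3)) ->
  2 * r * n + 4 * r <= s + r * r + 1 + 5 * n -> False.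
Proof.
move=> rn r3; have [e E] : exists e, r = e + 3 by exists (r - 3); lia.
have [k ->] : exists k, n = k + r.+2 by exists (n - r.+2); lia.
rewrite {}E {r3 rn} => h1 h2.
rewrite (_ : e + 3 - 1 = e + 2) in h1; last by lia.
rewrite (_ : k + (e + 3).+2 - (e + 3) = k + 2) in h1; last by lia.
rewrite (_ : e + 3 - 3 = e) in h1; last by lia.
by lia.
Qed.

(** The case of [h] arbitrary vertices and degrees at most [r - 1] elsewhere: the others account for
    [h + r - 1 <= 2 r - 6] each. *)
Lemma low_arith r n s h : r.+2 <= n -> h + 5 <= r ->
  s <= h * (h - 1) + (n - h) * (h + (r - 1)) ->
  2 * r * n + 4 * r <= s + r * r + 1 + 5 * n -> False.
Proof.
move=> rn hr; have [e E] : exists e, r = h + e + 5 by exists (r - h - 5); lia.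
have [k ->] : exists k, n = k + r.+2 by exists (n - r.+2); lia.
rewrite {}E {hr rn} => h1 h2.
rewrite (_ : h + e + 5 - 1 = h + e + 4) in h1; last by lia.
rewrite (_ : k + (h + e + 5).+2 - h = k + e + 7) in h1; last by lia.
have h3 : h * (h - 1) <= h * h by apply: leq_mul => //; lia.
case: h h1 h2 h3 => [|h]; last rewrite subSS subn0; by lia.
Qed.

Section Upper.
Variable V : finType.
Implicit Types (G : rel V) (A B C T U : {set V}).

Lemma sum_bound G U A k : sgraph G -> (forall x y, G x y -> x \in U) -> A \subset U ->
  {in U :\: A, forall x, #|nb G x :&: A| + dg G x <= k} ->
  \sum_x dg G x <= #|A| * (#|A| - 1) + (#|U| - #|A|) * k.
Proof.
move=> sG inU AU le; have [S I] := sG; rewrite (sum_dg_split A S); apply: leq_add.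
  rewrite -sum_nat_const; apply: leq_sum => x xA.
  by have := nbIC_lt sG xA; clear; lia.
have <- : #|U :\: A| = #|U| - #|A| by rewrite cardsD (setIidPr AU).
rewrite -sum_nat_const.
rewrite big_mkcond [X in _ <= X]big_mkcond /=; apply: leq_sum => x _.
rewrite !inE; case: (boolP (x \in A)) => //= xA; case: (boolP (x \in U)) => xU /=.
  by apply: le; rewrite inE xA.
have nb0 : nb G x = set0.
  by apply/setP => y; rewrite !inE; apply: contraNF xU => g; apply: (inU x y).
by rewrite /dg nb0 set0I cards0.
Qed.

Lemma low_step r G U : 3 <= r -> sgraph G -> (forall x y, G x y -> x \in U) ->
  5 * r + 18 <= #|U| ->
  2 * r * #|U| + 4 * r <= \sum_x dg G x + r * r + 1 + 5 * #|U| ->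
  #|[set x | r <= dg G x]| <= r ->
  exists G' C, [/\ sgraph G', dg G' =1 dg G, C \subset U, #|C| = r.+1 & good G' C].
Proof.
move=> r3 sG inU U5 sum few.
have [|C [CU cC top]] := @top_set V U (dg G) r.+1; first by move: U5; clear; lia.
have dg0 x : x \notin U -> dg G x = 0.
  move=> xU; apply/eqP; rewrite cards_eq0; apply/eqP/setP => y; rewrite !inE.
  by apply: contraNF xU => g; apply: (inU x y).
have top' c o : c \in C -> o \notin C -> dg G o <= dg G c.
  move=> c0 o0; have [oU|oU] := boolP (o \in U); first exact: top.
  by rewrite dg0.
have [c0 c0C c0r] : exists2 c, c \in C & dg G c < r.
  apply: NNPP => no; have : C \subset [set x | r <= dg G x].
    apply/subsetP => c c1; rewrite inE leqNgt; apply/negP => lt; apply: no.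
    by exists c.
  by move/subset_leq_card; rewrite cC; move: few; clear; lia.
have tail : low_tail U C r G.
  by split=> // y yC; apply: leq_ltn_trans (top' _ _ c0C yC) c0r.
have deg2 c : c \in C -> r <= dg G c + 2.
  move=> c1; rewrite leqNgt; apply/negP => lt.
  have cA := cardsD1 c C; rewrite c1 cC add1n in cA; case: cA => cA.
  apply: (@sparse_arith r #|U| (\sum_x dg G x)) => //; first by move: U5; clear; lia.
  rewrite [X in X * (X - 1) + (_ - X) * _]cA; apply: sum_bound => //.
    by apply: subset_trans (subsetDl _ _) CU.
  move=> x; rewrite !inE negb_and negbK => /andP[h _].
  have lx : dg G x <= dg G c by case/orP: h => [/eqP->//|]; apply: top'.
  by have := dg_split G (C :\ c) x; move: lx lt; clear; lia.
have [||G1 [s1 d1] G1max] := @max_exists (rel V) (fun H => sgraph H /\ dg H =1 dg G)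
    (fun H => #|inner_edges C H|) #|[set: V * V]|.
- by exists G.
- by move=> H _; apply: subset_leq_card; apply: subsetT.
have tail1 := low_tail_same s1 d1 tail.
have max1 G' : sgraph G' -> dg G' =1 dg G1 -> #|inner_edges C G'| <= #|inner_edges C G1|.
  by move=> s' d'; apply: G1max; split=> // x; rewrite d' d1.
have deg21 c : c \in C -> r <= dg G1 c + 2 by rewrite d1; apply: deg2.
suff sum6 : \sum_(x in C) #|missing C G1 x| <= 6.
  have [G' [s' d' g']] := deficit_good CU cC U5 tail1 max1 deg21 sum6.
  by exists G', C; split=> // x; rewrite d' d1.
have [[c1 c1C lt]|no] := classic (exists2 c, c \in C & dg G c + 1 < r).
  apply: (sum_missing_tight CU cC r3 U5 tail1 max1) => // o oC; rewrite d1.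
  by have := top' _ _ c1C oC; move: lt; clear; lia.
have deg1 c : c \in C -> r <= dg G1 c + 1.
  by move=> c1; rewrite d1 leqNgt; apply/negP => lt; apply: no; exists c.
apply: (sum_missing_flat CU cC U5 tail1 max1) => //.
rewrite leqNgt; apply/negP => N6.
set N := [set c in C | dg G1 c < r] in N6.
have NC : N \subset C by apply/subsetP => x; rewrite inE => /andP[].
have cN : #|C :\: N| = r.+1 - #|N| by rewrite cardsD (setIidPr NC) cC.
have leN := subset_leq_card NC; rewrite cC in leN.
apply: (@low_arith r #|U| (\sum_x dg G x) #|C :\: N|) => //.
- by move: U5; clear; lia.
- by move: N6 leN; rewrite cN; clear; lia.
apply: sum_bound => //; first by apply: subset_trans (subsetDl _ _) CU.
move=> x; rewrite !inE => /andP[h _]; apply: leq_add.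
  exact/subset_leq_card/subsetIr.
suff : dg G x < r by clear; lia.
move: h; case: (boolP (x \in C)) => xC /=; first by rewrite d1 andbT negbK.
by move=> _; apply: leq_ltn_trans (top' _ _ c0C xC) c0r.
Qed.

Lemma attains_all r : 2 <= r -> attains V r.
Proof.
case: r => [|[|r]] // _; elim: r => [|r IH] G U sG inU U5 U42 sum.
  (* For [r = 2] any three vertices serve: with labels 0, 1, 2 every pair is an edge of the triangle
     and may be missing. *)
  have [|C sC cC] := @subset_of_card V U 3; first by move: U5; clear; lia.
  exists G, C; split=> //.
  have [l lE] : exists l : V -> nat, {in C &, injective l} /\ forall x, x \in C -> l x < 3.
    exists (fun x => index x (enum C)); split=> [x y xC yC E|x xC].
      by rewrite -(nth_index x (_ : x \in enum C)) ?mem_enum // E nth_index // mem_enum.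
    by rewrite -cC cardE index_mem mem_enum.
  case: lE => inj lt; exists l; split=> // x y xC yC nxy _.
  have := lt x xC; have := lt y yC; have : l x != l y by apply: contraNneq nxy => /inj->.
  by case: (l x) => [|[|[|i]]] //; case: (l y) => [|[|[|j]]].
have [many|few] := leqP r.+4 #|[set x | r.+3 <= dg G x]|.
  exact: (peel_step _ IH sG inU U5 U42 sum many).
exact: (low_step _ sG inU U5 sum few).
Qed.

(** A label that is at least [#|C| >= 7] belongs to a vertex adjacent to all of [C], so any free
    label below [#|C|] can replace it, even one of a pattern vertex. The sum of labels drops. *)
Lemma good_normalize G C : 7 <= #|C| -> good G C -> exists l : V -> nat,
  [/\ {in C &, injective l}, forall x, x \in C -> l x < #|C| &
  {in C &, forall x y, x != y -> ~~ G x y -> K3P3_edge (l x) (l y)}].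
Proof.
move=> c7 [l0 [inj0 E0]].
have [k Hk] := ubnP (\sum_(x in C) l0 x); elim: k l0 inj0 E0 Hk => // k IH l inj lE Hk.
have [all|] := classic (forall x, x \in C -> l x < #|C|); first by exists l; split.
move=> nall; have [x xC big] : exists2 x, x \in C & #|C| <= l x.
  apply: NNPP => no; apply: nall => x xC; rewrite ltnNge; apply/negP => h.
  by apply: no; exists x.
have [m mC mfree] : exists2 m, m < #|C| & forall y, y \in C -> l y != m.
  apply: NNPP => no.
  have sub : {subset iota 0 #|C| <= [seq l y | y <- enum (C :\ x)]}.
    move=> m; rewrite mem_iota add0n => /= mC; apply/negPn/negP => nm; apply: no.
    exists m => // y yC; apply: contraNneq nm => E; rewrite -E map_f // mem_enum !inE yC andbT.
    by apply: contraTneq mC => E'; rewrite -E E' -leqNgt.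
  have := uniq_leq_size (iota_uniq 0 #|C|) sub.
  by rewrite size_iota size_map -cardE; have := cardsD1 x C; rewrite xC; clear; lia.
have adjx y : y \in C -> x != y -> G x y.
  move=> yC nxy; apply/negPn/negP => ng; have := K3P3_edgeP (lE x y xC yC nxy ng).
  by rewrite /K3P3_nbrs nth_default //=; apply: leq_trans c7 big.
have adjx' y : y \in C -> x != y -> G y x.
  move=> yC nxy; apply/negPn/negP => ng; have nyx : y != x by rewrite eq_sym.
  have := lE y x yC xC nyx ng; rewrite K3P3_edge_sym => /K3P3_edgeP.
  by rewrite /K3P3_nbrs nth_default //=; apply: leq_trans c7 big.
apply: (IH (fun y => if y == x then m else l y)).
- move=> y z yC zC; case: (eqVneq y x) => [->|ny]; case: (eqVneq z x) => [->|nz] //.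
  + by move=> E; have := mfree z zC; rewrite E eqxx.
  + by move=> E; have := mfree y yC; rewrite E eqxx.
  + exact: inj.
- move=> y z yC zC nyz ng; case: (eqVneq y x) => [E|ny].
    by rewrite E in nyz ng; rewrite adjx in ng.
  case: (eqVneq z x) => [E|nz]; last exact: lE.
  by rewrite E in nyz ng; rewrite adjx' // eq_sym in ng.
rewrite -ltnS (leq_trans _ Hk) // ltnS (big_setD1 x) //= eqxx [X in _ < X](big_setD1 x) //=.
rewrite (eq_bigr l); last by move=> y; rewrite !inE => /andP[/negbTE->].
by rewrite ltn_add2r; apply: leq_trans mC big.
Qed.

Lemma good_contains r G C : 6 <= r -> #|C| = r.+1 -> good G C ->
  exists f : 'I_r.+1 -> V, injective f /\ forall i j, Kr1_minus_K3P3 r i j -> G (f i) (f j).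
Proof.
move=> r6 cC g; have [|l [inj lt lE]] := good_normalize _ g; first by rewrite cC.
have [x0 x0C] : exists x, x \in C by apply/card_gt0P; rewrite cC.
have surj (i : 'I_r.+1) : exists2 x, x \in C & l x == i.
  apply: NNPP => no.
  have sub : {subset val i :: [seq l x | x <- enum C] <= iota 0 r.+1}.
    move=> m; rewrite inE mem_iota add0n => /= /orP[/eqP->//|/mapP [x]].
    by rewrite mem_enum => xC ->; rewrite -cC lt.
  have uq : uniq (val i :: [seq l x | x <- enum C]).
    rewrite /= map_inj_in_uniq ?enum_uniq ?andbT.
      by apply/mapP => -[x]; rewrite mem_enum => xC E; apply: no; exists x => //; rewrite -E.
    by move=> x y; rewrite !mem_enum; apply: inj.
  have := uniq_leq_size uq sub; rewrite /= size_map size_iota -cardE cC.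
  by clear; lia.
pose f (i : 'I_r.+1) := odflt x0 [pick x in C | l x == i].
have fE i : f i \in C /\ l (f i) = i.
  rewrite /f; case: pickP => [x /andP[xC /eqP]|no] //=.
  by have [x xC E] := surj i; have := no x; rewrite xC E.
exists f; split=> [i j E|i j /andP[nij nK]].
  by apply: val_inj; rewrite /= -(fE i).2 -(fE j).2 E.
have [iC li] := fE i; have [jC lj] := fE j.
apply/negPn/negP => ng; case/negP: nK; rewrite -li -lj; apply: lE => //.
by apply: contraNneq nij => E; apply/eqP/val_inj; rewrite /= -li -lj E.
Qed.

End Upper.

(** * The extremal sequence *)

(** Labels from 7 on are isolated in K_3 u P_3. Collapsing them to 7, which alone may then repeat,
    leaves a finite check. *)
Lemma K3P3_four a b c d : uniq [:: a; b; c; d] ->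
  K3P3_edge a b + K3P3_edge a c + K3P3_edge a d +
  K3P3_edge b c + K3P3_edge b d + K3P3_edge c d <= 3.
Proof.
move=> u; pose h x := minn x 7.
have big x y : 7 <= x -> K3P3_edge x y = false.
  by move=> x7; apply/negP => /K3P3_edgeP; rewrite /K3P3_nbrs nth_default.
have hE x y : K3P3_edge x y = K3P3_edge (h x) (h y).
  have [x7|x7] := ltnP x 7; last by rewrite !big // /h; lia.
  have [y7|y7] := ltnP y 7; last by rewrite K3P3_edge_sym [RHS]K3P3_edge_sym !big // /h; lia.
  by rewrite /h (minn_idPl (ltnW x7)) (minn_idPl (ltnW y7)).
have hin x : h x \in iota 0 8 by rewrite mem_iota /h; lia.
pose ne x y := (x != y) || (x == 7).
have hne x y : x != y -> ne (h x) (h y) by rewrite /ne /h; lia.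
have check : all (fun a => all (fun b => all (fun c => all (fun d =>
    [&& ne a b, ne a c, ne a d, ne b c, ne b d & ne c d] ==>
  (K3P3_edge a b + K3P3_edge a c + K3P3_edge a d +
   K3P3_edge b c + K3P3_edge b d + K3P3_edge c d <= 3))
  (iota 0 8)) (iota 0 8)) (iota 0 8)) (iota 0 8) by vm_compute.
move: u; rewrite /= !inE !negb_or => /and4P[/and3P[ab ac ad] /andP[bc bd] cd _].
rewrite (hE a b) (hE a c) (hE a d) (hE b c) (hE b d) (hE c d).
move/allP/(_ _ (hin a))/allP/(_ _ (hin b))/allP/(_ _ (hin c))/allP/(_ _ (hin d)): check.
by move/implyP; apply; rewrite !hne.
Qed.

Lemma card_ord_lt n k : k <= n -> #|[set j : 'I_n | j < k]| = k.
Proof.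
move=> kn; rewrite -sum1dep_card -(big_ord_widen n (fun=> 1) kn) sum_nat_const card_ord.
by rewrite muln1.
Qed.

(* A star with [c] leaves and a perfect matching of the remaining vertices. *)
Definition inner_adj (c a b : nat) :=
  [|| (a == 0) && (0 < b <= c), (b == 0) && (0 < a <= c) |
      [&& c < a, c < b & (a - c - 1)./2 == (b - c - 1)./2]].

Lemma inner_adj_center c b : inner_adj c 0 b = (0 < b <= c).
Proof. by rewrite /inner_adj eqxx /= andbF !orbF. Qed.

Lemma inner_adj_leaf c a b : 0 < a <= c -> inner_adj c a b = (b == 0).
Proof.
rewrite /inner_adj => h; rewrite h andbT (ltnNge c) ; case/andP: h => a0 ->.
by rewrite (gtn_eqF a0) orbF.
Qed.

Lemma inner_adj_match c a b : c < a -> b != a ->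
  inner_adj c a b = (b == if odd (a - c - 1) then a - 1 else a + 1).
Proof.
rewrite /inner_adj => ca ba; rewrite ca (leqNgt a) ca !andbF /=.
have -> /= : (a == 0) = false by lia.
have [x Ea] : exists x, a = x + c + 1 by exists (a - c - 1); lia.
rewrite Ea in ca ba *.
have -> : x + c + 1 - c - 1 = x by lia.
case: (leqP b c) => bc /=; first by case: ifP; lia.
have [y E] : exists y, b = y + c + 1 by exists (b - c - 1); lia.
have -> : b - c - 1 = y by lia.
have := odd_double_half x; have := odd_double_half y; rewrite E in ba *.
by case: (odd x); case: (odd y) => /= h1 h2; apply/eqP/eqP; lia.
Qed.

Section Extremal.
Variables (n k c : nat).
Hypotheses (c0 : 0 < c) (c2 : c <= 2) (nk : k + c < n) (par : ~~ odd (n - k - 1 - c)).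

(** For [c = 1] the vertices from index [k] on span a perfect matching, for [c = 2] a two-edge path
    centred at index [k] and a matching; parity decides between them. *)
Definition extremal_seq := nseq k (n - 1) ++ (k + c) :: nseq (n - k - 1) (k + 1).

Definition extremal_graph : rel 'I_n := fun i j =>
  (i != j) && [|| i < k, j < k | inner_adj c (i - k) (j - k)].

Lemma extremal_nth i : nth 0 extremal_seq i =
  if i < k then n - 1 else if i == k then k + c else if i < n then k + 1 else 0.
Proof.
rewrite /extremal_seq nth_cat size_nseq nth_nseq; case: ltnP => // ki.
case: eqVneq => [->|ne]; first by rewrite subnn.
have -> : i - k = (i - k - 1).+1 by lia.
rewrite /= nth_nseq; case: ltnP => h1; case: ltnP => h2 //; lia.
Qed.

Lemma extremal_sgraph : simple_graph extremal_graph.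
Proof.
split=> [i j|i]; rewrite /extremal_graph ?eqxx //.
rewrite eq_sym /inner_adj; case: (i < k); case: (j < k); rewrite ?orbT //=.
by rewrite [in RHS]orbCA (andbCA (c < i - k)) [in RHS](eq_sym _./2).
Qed.

Lemma extremal_deg i : deg extremal_graph i = nth 0 extremal_seq i.
Proof.
rewrite extremal_nth ltn_ord /deg; have nE : n = n.-1.+1 by lia.
case: ltnP => ki.
  have -> : [set j | extremal_graph i j] = [set~ i].
    by apply/setP => j; rewrite !inE /extremal_graph ki eq_sym andbT.
  by rewrite cardsC1 card_ord; lia.
have base := @card_ord_lt n k (ltnW (leq_ltn_trans (leq_addr c k) nk)).
have one (p : 'I_n) : k <= p -> (forall j : 'I_n, k <= j -> extremal_graph i j = (j == p)) ->
    #|[set j | extremal_graph i j]| = k + 1.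
  move=> kp pE; have -> : [set j | extremal_graph i j] = p |: [set j : 'I_n | j < k].
    apply/setP => j; rewrite !inE; case: (ltnP j k) => kj; last by rewrite pE // orbF.
    rewrite orbT /extremal_graph kj orbT andbT; apply/eqP => E; move: ki; rewrite E; lia.
  by rewrite cardsU1 inE base ltnNge kp addnC.
have gE (j : 'I_n) : k <= j -> extremal_graph i j = (i != j) && inner_adj c (i - k) (j - k).
  by move=> kj; rewrite /extremal_graph !ltnNge ki kj.
case: (eqVneq (nat_of_ord i) k) => [ik|ik].
  have {}gE (j : 'I_n) : k <= j -> extremal_graph i j = (k < j <= k + c).
    move=> kj; rewrite gE // -val_eqE /= ik subnn inner_adj_center.
    by move: kj; clear; lia.
  have lt1 : k + 1 < n by move: nk c0; clear; lia.
  case: (leqP c 1) => c1.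
    have c11 : c = 1 by move: c0 c1; clear; lia.
    rewrite c11; apply: (one (Ordinal lt1)) => [|j kj]; first by rewrite /= leq_addr.
    by rewrite gE // -val_eqE /= c11; clear; lia.
  have E2 : c = 2 by move: c1 c2; clear; lia.
  have lt2 : k + 2 < n by rewrite -E2.
  have -> : [set j | extremal_graph i j] =
      Ordinal lt1 |: (Ordinal lt2 |: [set j : 'I_n | j < k]).
    apply/setP => j; rewrite !inE -!val_eqE /=; case: (ltnP j k) => kj; last first.
      by rewrite gE // E2; clear; lia.
    rewrite !orbT /extremal_graph kj orbT andbT -val_eqE /= ik.
    by move: kj; clear; lia.
  by rewrite !cardsU1 !inE base -val_eqE /= E2; clear; lia.
have ik' : k < i by rewrite ltn_neqAle eq_sym ik.
case: (leqP (i - k) c) => ic.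
  have lt0 : k < n by move: nk; clear; lia.
  apply: (one (Ordinal lt0)) => // j kj.
  rewrite gE // inner_adj_leaf ?ic ?subn_gt0 ?ik' // -!val_eqE /=.
  by move: kj ik'; clear; lia.
pose p := if odd (i - k - c - 1) then i - 1 else i + 1.
have pn : p < n.
  by rewrite /p; have := ltn_ord i; move: par ic; clear; case: ifP; lia.
apply: (one (Ordinal pn)) => [|j kj].
  by rewrite /= /p; move: ik'; clear; case: ifP; lia.
rewrite gE //; have [ij|ij] := eqVneq i j.
  by rewrite -val_eqE -ij /= /p; move: ik'; clear; case: ifP; lia.
rewrite inner_adj_match // -?val_eqE /= /p.
  by move: kj ik'; clear; case: ifP; lia.
by move: ij kj ki; rewrite -val_eqE /=; clear; lia.
Qed.

Lemma size_extremal : size extremal_seq = n.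
Proof. by rewrite /extremal_seq size_cat /= !size_nseq; lia. Qed.

Lemma sumn_extremal : sumn extremal_seq = k * (n - 1) + (k + c) + (n - k - 1) * (k + 1).
Proof. by rewrite /extremal_seq sumn_cat /= !sumn_nseq; clear; lia. Qed.

Lemma extremal_sorted : sorted geq extremal_seq.
Proof.
apply/(sortedP 0) => i; rewrite size_extremal => lt; rewrite /geq /= !extremal_nth.
by do ! case: ifP; lia.
Qed.

Lemma extremal_graphic : graphic n extremal_seq.
Proof.
split; first exact: extremal_sorted.
split; first exact: size_extremal.
exists extremal_graph; split; first exact: extremal_sgraph.
by split; [exact: size_extremal|exact: extremal_deg].
Qed.

(** In every realization the [k] vertices of degree [n - 1] are adjacent to all others, which fixes
    the degrees among the remaining vertices. *)
Lemma extremal_outer_deg (g : rel 'I_n) (i : 'I_n) : realization g extremal_seq -> k <= i ->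
  #|[set j : 'I_n | g i j && (k <= j)]| <= 1 + (i == k :> nat).
Proof.
move=> [[S I] [_ dE]] ki.
have full (x j : 'I_n) : x < k -> x != j -> g x j.
  move=> xk nxj; have := dE x; rewrite extremal_nth xk /deg => dx.
  have sub : [set y | g x y] \subset [set~ x].
    by apply/subsetP => y; rewrite !inE; apply: contraTneq => ->; rewrite I.
  have /setP/(_ j) : [set y | g x y] = [set~ x].
    by apply/eqP; rewrite eqEcard sub cardsC1 card_ord dx; lia.
  by rewrite !inE eq_sym nxj.
have := dE i; rewrite extremal_nth ltn_ord ltnNge ki /= /deg.
rewrite -(cardsID [set j : 'I_n | j < k]) (setIidPr _).
  rewrite card_ord_lt; last by lia.
  have -> : [set j | g i j] :\: [set j : 'I_n | j < k] = [set j : 'I_n | g i j && (k <= j)].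
    by apply/setP => j; rewrite !inE -leqNgt andbC.
  by case: eqVneq => _ /=; lia.
apply/subsetP => j; rewrite !inE => jk; rewrite S; apply: full => //.
by apply: contraTneq jk => ->; rewrite -leqNgt.
Qed.

Lemma extremal_not_potential : ~ potentially_graphic (Kr1_minus_K3P3 (k + 3)) n extremal_seq.
Proof.
move=> [g [rg [f [finj fH]]]].
pose T0 := [set x : 'I_(k + 3).+1 | k <= f x].
have T04 : 4 <= #|T0|.
  have : #|~: T0| <= k.
    rewrite -(card_imset _ finj) -[X in _ <= X](@card_ord_lt n k); last by lia.
    by apply/subset_leq_card/subsetP => y /imsetP [x]; rewrite !inE -ltnNge => h ->.
  by have := cardsC T0; rewrite card_ord; lia.
have [T sT cT] := subset_of_card T04.
(* The images of [T] avoid the [k] dominating vertices, so they span at most [4 + 1] ordered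
   adjacent pairs; [K3P3_four] demands at least [2 (6 - 3) = 6]. *)
have up : \sum_(x in T) \sum_(y in T) (Kr1_minus_K3P3 (k + 3) x y : nat) <= 5.
  apply: (@leq_trans (\sum_(x in T) (1 + (f x == k :> nat)))).
    apply: leq_sum => x xT; have kx : k <= f x by have := subsetP sT x xT; rewrite inE.
    apply: leq_trans (extremal_outer_deg rg kx).
    apply: (@leq_trans #|f @: [set y in T | Kr1_minus_K3P3 (k + 3) x y]|).
      rewrite card_imset // -sum1_card big_mkcond [X in _ <= X]big_mkcond /=.
      by apply: leq_sum => y _; rewrite inE; case: (y \in T) => //=; case: (Kr1_minus_K3P3 _ _ _).
    apply/subset_leq_card/subsetP => z /imsetP [y]; rewrite inE => /andP[yT h] ->.
    by rewrite inE fH //=; have := subsetP sT y yT; rewrite inE.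
  rewrite big_split /= sum1_card cT leq_add2l.
  have [/existsP [x0 /andP[x0T /eqP x0k]]|no] := boolP [exists x, (x \in T) && (f x == k :> nat)].
    rewrite (bigD1 x0) //= big1 ?addn0 ?x0k ?eqxx // => x /andP[xT nx].
    by apply/eqP; rewrite eqb0; apply: contraNneq nx => E; apply/eqP/finj/val_inj; rewrite /= x0k.
  rewrite big1 // => x xT; apply/eqP; rewrite eqb0; apply: contra no => h.
  by apply/existsP; exists x; rewrite xT.
have := enum_uniq (mem T); have : size (enum T) = 4 by rewrite -cardE.
move: up; rewrite -big_enum; under eq_bigr => x _ do rewrite -big_enum /=.
case: (enum T) => [|a [|b [|c' [|d [|]]]]] // up _ u.
have uv : uniq [:: val a; val b; val c'; val d].
  by move: u; rewrite -(map_inj_uniq val_inj).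
have four := K3P3_four uv.
move: u; rewrite /= !inE !negb_or => /and4P[/and3P[ab ac ad] /andP[bc bd] cd _].
move: up; rewrite !big_cons !big_nil /Kr1_minus_K3P3 !eqxx /= ?(eq_sym b a) ?(eq_sym c' a) ?(eq_sym d a).
rewrite ?(eq_sym c' b) ?(eq_sym d b) ?(eq_sym d c') ab ac ad bc bd cd /=.
rewrite (K3P3_edge_sym b a) (K3P3_edge_sym c' a) (K3P3_edge_sym d a).
rewrite (K3P3_edge_sym c' b) (K3P3_edge_sym d b) (K3P3_edge_sym d c').
move: four; clear.
case: (K3P3_edge a b); case: (K3P3_edge a c'); case: (K3P3_edge a d);
  by case: (K3P3_edge b c'); case: (K3P3_edge b d); case: (K3P3_edge c' d).
Qed.

End Extremal.

Lemma value_extremal r n : 6 <= r -> 5 * r + 18 <= n ->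
  (if odd (n - r) then (r - 1) * (2 * n - r) - 3 * (n - r) - 1
   else (r - 1) * (2 * n - r) - 3 * (n - r)) =
  (r - 3) * (n - 1) + (r - 3 + (~~ odd (n - r)).+1) + (n - (r - 3) - 1) * (r - 3 + 1) + 2.
Proof.
move=> r6 n5; have [k E] : exists k, r = k + 3 by exists (r - 3); lia.
have [q Eq] : exists q, n = q + r by exists (n - r); lia.
rewrite Eq addnK; rewrite {}E in r6 n5 Eq *.
have -> : k + 3 - 1 = k + 2 by lia.
have -> : k + 3 - 3 = k by lia.
have -> : 2 * (q + (k + 3)) - (k + 3) = 2 * q + k + 3 by lia.
have -> : q + (k + 3) - 1 = q + k + 2 by lia.
have -> : q + (k + 3) - k - 1 = q + 2 by lia.
have -> : (k + 2) * (2 * q + k + 3) = 3 * q + (2 * k * q + q + (k + 2) * (k + 3)) by lia.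
rewrite addKn; case: (odd q) => /=; lia.
Qed.

(** Both parities are reduced to the threshold for odd [n - r], which is the case [c = 1]. *)
Lemma threshold_arith k c n s : 0 < c -> k + 3 <= n ->
  k * (n - 1) + (k + c) + (n - k - 1) * (k + 1) + 2 <= s ->
  2 * (k + 3) * n + 4 * (k + 3) <= s + (k + 3) * (k + 3) + 1 + 5 * n.
Proof.
move=> c0 kn; have [q ->] : exists q, n = q + k + 3 by exists (n - k - 3); lia.
have -> : q + k + 3 - 1 = q + k + 2 by lia.
have -> : q + k + 3 - k - 1 = q + 2 by lia.
by lia.
Qed.

Theorem theorem1p1 (r n : nat) :
  6 <= r -> 5 * r + 18 <= n ->
  is_sigma (Kr1_minus_K3P3 r) n
    (if odd (n - r)
     then (r - 1) * (2 * n - r) - 3 * (n - r) - 1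
     else (r - 1) * (2 * n - r) - 3 * (n - r)).
Proof.
move=> r6 n5; rewrite (value_extremal r6 n5).
set k := r - 3; set c := (~~ odd (n - r)).+1.
have kr : k + 3 = r by rewrite /k; lia.
have cE : c = if odd (n - r) then 1 else 2 by rewrite /c; case: (odd _).
have c0 : 0 < c by [].
have c2 : c <= 2 by rewrite cE; case: ifP.
have nk : k + c < n by move: kr c2 n5; clear; lia.
have par : ~~ odd (n - k - 1 - c).
  have [q Eq] : exists q, n = q + r by exists (n - r); move: n5; clear; lia.
  rewrite cE Eq -kr addnK.
  have [m Em] : exists m, q = m.+2 by exists q.-2; move: Eq kr n5; clear; lia.
  by rewrite Em; case: ifP => /= h;
    [have -> : m.+2 + (k + 3) - k - 1 - 1 = m.+3 by lia|
     have -> : m.+2 + (k + 3) - k - 1 - 2 = m.+2 by lia]; move: h => /=; case: (odd m).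
have sumE := sumn_extremal n k c.
have ev : ~~ odd (sumn (extremal_seq n k c)).
  rewrite sumE; have [q Eq] : exists q, n - k - 1 = q + c by exists (n - k - 1 - c); move: nk; clear; lia.
  have -> : n - 1 = q + c + k by move: Eq nk; clear; lia.
  rewrite Eq addnK in par; rewrite Eq !(oddD, oddM) (negbTE par).
  by clear; case: (odd k); case: (odd c).
split; first by rewrite -sumE addn2 /= negbK.
split.
  move=> pi [_ [szpi [g rg]]]; rewrite /seq_sum => le.
  have [sg [_ dE]] := rg.
  have sumpi : sumn pi = \sum_i dg g i.
    rewrite sumnE (big_nth 0) szpi big_mkord; apply: eq_bigr => i _.
    by rewrite -dE.
  have [||||||G' [C [s' d' _ cC good']]] := @attains_all 'I_n r _ g [set: 'I_n]; rewrite ?cardsT ?card_ord //.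
  - by move: r6; clear; lia.
  - by move: r6 n5; clear; lia.
  - rewrite -sumpi -kr; apply: threshold_arith le => //.
    by move: kr n5; clear; lia.
  have [f [finj fH]] := good_contains r6 cC good'.
  exists G'; split; last by exists f; split.
  by split=> //; split=> // i; rewrite -dE; exact: d'.
(* Both [l] and the extremal sum are even, so an [l] below that sum plus 2 does not exceed it, and
   [sig] would apply to the extremal sequence. *)
move=> l lev sig; rewrite leqNgt; apply/negP => lt.
have gr := extremal_graphic c0 c2 nk par.
have := extremal_not_potential c0 c2 nk par; rewrite kr; apply.
apply: sig => //; rewrite /seq_sum sumE; rewrite sumE in ev.
move: lt lev ev; set s := (_ + _ + _); clear; lia.
Qed.
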